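(* Let $T$ be a finite tree. There is a constant $C_T$, depending only on $T$, such that for every finite graph $G$ which does not have $T$ as a minor and every metric $d_w$ supported on $G$, $\mathsf{La}((G,d_w))$ bi-Lipschitzly embeds into $L_1$ with distortion at most $C_T$.
   Context: A metric $d_w$ is supported on a graph $G=(V,E)$ if it is the shortest path metric on $V$ with respect to some weight function $w\colon E\to[0,\infty)$ (always assumed reduced: $d_w(x,y)=w((x,y))$ for $(x,y)\in E$). $(G,d_w)$ denotes the metric space $(V,d_w)$. For a finite metric space $(X,d_X)$, points $x,y\in X$ and $C\subset X$, $\mathrm{tsp}_X(x,C,y)$ is the minimum of $\sum_{i=1}^n d_X(x_{i-1},x_i)$ over all finite sequences $x_0,\dots,x_n$ ($n\ge0$) in $X$ with $x_0=x$, $x_n=y$, $C\subset\{x_0,\dots,x_n\}$. The lamplighter metric space $\mathsf{La}(X)$ is the set of pairs $(A,x)$, with $A$ a finite subset of $X$ and $x\in X$, with the metric $d_{\mathsf{La}(X)}((A,x),(B,y))=\mathrm{tsp}_X(x,A\triangle B,y)+|A\triangle B|$. A metric space $(M,d_M)$ bi-Lipschitzly embeds into $L_1$ with distortion at most $D$ if there are $s>0$ and $f\colon M\to L_1$ with $s\,d_M(x,y)\le\|f(x)-f(y)\|_1\le D s\,d_M(x,y)$ for all $x,y\in M$. *)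

(* Defs.v *)
From HB Require Import structures.
From mathcomp Require Import all_boot all_order all_algebra.
From mathcomp Require Import all_classical all_reals all_analysis.

Set Implicit Arguments.
Unset Strict Implicit.
Unset Printing Implicit Defensive.

Import Order.TTheory GRing.Theory Num.Theory.
Import numFieldNormedType.Exports.

Local Open Scope ring_scope.

Record graph := Graph {
  vertex :> finType;
  adj : rel vertex;
  adj_sym : symmetric adj;
  adj_irr : irreflexive adj
}.
Arguments adj {g}.

(* The subgraph of G induced by B is connected, hence nonempty. *)
Definition connected_in (G : graph) (B : {set G}) : Prop :=
  (exists x, x \in B) /\
  {in B &, forall x y, connect [rel u v | [&& u \in B, v \in B & adj u v]] x y}.

Definition is_tree (T : graph) : Prop :=
  connected_in [set: T]%SET /\
  forall c : seq T, (2 < size c)%N -> ~ ucycle adj c.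

(* H is a minor of G: phi gives the branch sets of a model of H in G. *)
Definition is_minor (H G : graph) : Prop :=
  exists phi : H -> {set G},
    [/\ forall a, connected_in (phi a),
        forall a b, a != b -> [disjoint phi a & phi b] &
        forall a b, adj a b ->
          exists x y, [/\ x \in phi a, y \in phi b & adj x y]].

Section Metric.
Variable R : realType.

Definition is_metric (X : Type) (d : X -> X -> R) : Prop :=
  [/\ forall x y, d x y = 0 <-> x = y,
      forall x y, d x y = d y x &
      forall x y z, d x z <= d x y + d y z].

Definition is_minimum (S : set R) (m : R) : Prop := S m /\ lbound S m.

(* For s = [:: x1; ...; xn] this is w x x1 + w x1 x2 + ... + w x(n-1) xn. *)
Definition seq_length (X : Type) (w : X -> X -> R) (x : X) (s : seq X) : R :=
  \sum_(r <- pairmap w x s) r.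

(* Lengths of the walks from x to y in G for the edge weights w. *)
Definition walk_lengths (G : graph) (w : G -> G -> R) (x y : G) : set R :=
  [set r | exists s : seq G,
     [/\ path adj x s, last x s = y & r = seq_length w x s]].

(* Only the values of the weight w on adjacent pairs matter. *)
Definition supported_on (G : graph) (d : G -> G -> R) : Prop :=
  is_metric d /\
  exists w : G -> G -> R,
    [/\ forall x y, adj x y -> 0 <= w x y,
        forall x y, adj x y -> w x y = w y x,
        forall x y, is_minimum (walk_lengths w x y) (d x y) &
        forall x y, adj x y -> d x y = w x y].

Definition tour_lengths (X : finType) (d : X -> X -> R)
    (x : X) (C : {set X}) (y : X) : set R :=
  [set r | exists s : seq X,
     [/\ last x s = y, {subset C <= x :: s} & r = seq_length d x s]].

(* When d is a metric this infimum is attained, see tsp_minimum. *)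
Definition tsp (X : finType) (d : X -> X -> R) (x : X) (C : {set X}) (y : X) : R :=
  inf (tour_lengths d x C y).

Lemma seq_length_cons (X : Type) (w : X -> X -> R) x y s :
  seq_length w x (y :: s) = w x y + seq_length w y s.
Proof. by rewrite /seq_length /= big_cons. Qed.

Section Tsp.
Variables (X : finType) (d : X -> X -> R).
Hypothesis dm : is_metric d.

Lemma seq_length_subseq x y s t : subseq s t ->
  seq_length d x (rcons s y) <= seq_length d x (rcons t y).
Proof.
have [_ _ dD] := dm.
suff shortcut u v z r : seq_length d u (z :: r) <= d u v + seq_length d v (z :: r).
  elim: t s x => [|b t IH] s x; first by rewrite subseq0 => /eqP ->.
  case: s => [|a s] /=.
    move=> _; rewrite [leRHS]seq_length_cons.
    apply: (le_trans (shortcut x b y [::])); rewrite lerD2l.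
    exact: (IH [::] b (sub0seq _)).
  case: eqP => [-> st|_ st].
    by rewrite !seq_length_cons lerD2l IH.
  rewrite [leRHS]seq_length_cons.
  apply: (le_trans (shortcut x b a (rcons s y))); rewrite lerD2l.
  exact: (IH (a :: s) b st).
by rewrite !seq_length_cons addrA lerD2r.
Qed.

Lemma tsp_minimum x C y : is_minimum (tour_lengths d x C y) (tsp d x C y).
Proof.
pose n := #|X|.+1.
pose good (s : n.-bseq X) :=
  (last x s == y) && [forall c in C, c \in x :: s].
have goodP (s : n.-bseq X) :
    good s -> last x s = y /\ {subset C <= x :: s}.
  by move=> /andP[/eqP -> /forall_inP H]; split.
have short r : tour_lengths d x C y r ->
    exists2 s : n.-bseq X, good s & seq_length d x s <= r.
  move=> [s [ls Cs ->]].
  suff [t [t1 t2 t3 t4]] : exists t : seq X, [/\ (size t <= n)%N, last x t = y,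
      {subset C <= x :: t} & seq_length d x t <= seq_length d x s].
    exists (Bseq t1) => //; apply/andP; split; first by rewrite /= t2.
    by apply/forall_inP => c /t3.
  case/lastP: s ls Cs => [|s z] ls Cs; first by exists [::].
  move: ls; rewrite last_rcons => <-.
  exists (rcons (undup s) z); split.
  - by rewrite size_rcons ltnS -(card_uniqP (undup_uniq s)) max_card.
  - by rewrite last_rcons.
  - by move=> c /Cs; rewrite !inE !mem_rcons !inE mem_undup.
  - exact: seq_length_subseq (undup_subseq s).
have [s0 good0] : exists s0, good s0.
  have [//|s gs _] := short (seq_length d x (rcons (enum X) y)); last by exists s.
  exists (rcons (enum X) y); split; rewrite ?last_rcons//.
  by move=> c _; rewrite !inE mem_rcons inE mem_enum !orbT.
case: (arg_minP (fun s : n.-bseq X => seq_length d x s) good0) => m gm mmin.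
have mS : tour_lengths d x C y (seq_length d x m).
  by have [? ?] := goodP _ gm; exists m.
have mlb : lbound (tour_lengths d x C y) (seq_length d x m).
  by move=> r /short[s gs sr]; exact: le_trans (mmin _ gs) sr.
suff -> : tsp d x C y = seq_length d x m by [].
apply/eqP; rewrite eq_le; apply/andP; split.
  by apply: ge_inf => //; exists (seq_length d x m).
by apply: lb_le_inf => //; exists (seq_length d x m).
Qed.

End Tsp.

Definition symdiff (X : finType) (A B : {set X}) : {set X} :=
  ((A :\: B) :|: (B :\: A))%SET.

(* X being finite, every subset of X is an admissible lamp configuration. *)
Definition lamplighter (X : finType) : Type := ({set X} * X)%type.

Definition lamplighter_dist (X : finType) (d : X -> X -> R)
    (p q : lamplighter X) : R :=
  tsp d p.2 (symdiff p.1 q.1) q.2 + #|symdiff p.1 q.1|%:R.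

Definition lebesgue01 := mrestr (@lebesgue_measure R) (measurable_itv `[0, 1]%R).

HB.instance Definition _ := Measure.on lebesgue01.

(* Elements of L_1[0, 1] are given by representatives. *)
Local Notation L1 := (LfunType lebesgue01 (lexx (1%E : \bar R))).

Definition L1_norm (f : L1) : \bar R := 'N[lebesgue01]_1[EFin \o f]%E.

Definition embeds_L1 (M : Type) (dM : M -> M -> R) (D : R) : Prop :=
  exists (s : R) (f : M -> L1),
    0 < s /\
    forall x y, ((s * dM x y)%:E <= L1_norm (f x - f y)%R
                 <= (D * s * dM x y)%:E)%E.

End Metric.

(* Main.v *)
(** Metric side.  A weighted family of cuts [S] of the vertex set embeds the
    lamplighter space into a finite-dimensional l_1 space: the cut [S] compares
    the side of [S] on which the lamplighter stands together with the lamps on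
    the other side, and two states differ there exactly when [S] splits
    [{x, y} ∪ (A Δ B)].  The embedding has bounded distortion as soon as the
    cut metric is at most [D * d] on edges while, for every set [C], the total
    weight of the cuts splitting [C] is at least the cost of connecting [C].

    Such a family is built by peeling off a geodesic path [P].  The vertices
    outside [P] are grouped by a random scale [tau] of their distance to [P] and
    by a random slice of thickness [tau] of the distance to the start of [P];
    each connected piece is hung at one point of [P], at distance [O(tau)], and
    an edge of length [l] is cut with probability [O(l / tau)].  The pieces,
    whose inner distances only matter up to [O(tau)], are treated recursively.

    Graph side.  If [T] is not a minor of [G], the vertices of [G] can be
    enumerated so that every initial segment has less than [|T|] vertices with a
    neighbor outside it: otherwise a model of [T] is grown one vertex at a time,
    keeping one boundary vertex in each branch set (Diestel's proof that
    excluding a forest bounds the path-width).  A path from the first to the last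
    vertex meets all these boundaries, so that peeling it off lowers their size,
    and the recursion has depth at most [|T|]. *)
Require Import Defs.
From mathcomp Require Import all_boot all_order all_algebra.
From mathcomp Require Import all_classical all_reals all_analysis.
From mathcomp Require Import measurable_realfun.
From mathcomp Require Import zify lra.

Set Implicit Arguments.
Unset Strict Implicit.
Unset Printing Implicit Defensive.

Import Order.TTheory GRing.Theory Num.Theory.
Import numFieldNormedType.Exports.
Import boot.seq fintype boot.finset.

(** * Vertex boundaries and excluded trees *)

Section Boundary.
Variables (V : finType) (e : rel V) (H : {set V}).
Implicit Types A B X Y : {set V}.

(** Inner vertex boundary. The arcs [e] and the ground set [H] are parameters because arcs get
    deleted one at a time in [branches_extend], while [H] becomes an induced subgraph when paths are
    peeled off. *)
Definition bd X : {set V} := [set x in X | [exists y in H :\: X, e x y]].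

Lemma bdP X x :
  reflect (x \in X /\ exists y, [/\ y \in H, y \notin X & e x y]) (x \in bd X).
Proof.
rewrite inE; apply: (iffP andP) => [[xX /exists_inP[y]]|[xX [y [yH yX exy]]]].
  by rewrite inE => /andP[yX yH] exy; split => //; exists y.
by split=> //; apply/exists_inP; exists y => //; rewrite inE yX.
Qed.

(** Submodularity, by comparing unions and intersections of the two pairs of boundaries: a vertex in
    either boundary on the left lies in one of those on the right, and a vertex in both of them lies
    in both. *)
Lemma bd_submod A B : #|bd (A :&: B)| + #|bd (A :|: B)| <= #|bd A| + #|bd B|.
Proof.
rewrite -(cardsUI (bd A)) -(cardsUI (bd (A :&: B))).
apply: leq_add; apply/subset_leq_card/subsetP => x.
  rewrite !in_setU => /orP[] /bdP[]; rewrite ?in_setI ?in_setU.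
    move=> /andP[xA xB] [y [yH]]; rewrite in_setI negb_and => /orP[] yn exy.
      by apply/orP; left; apply/bdP; split => //; exists y.
    by apply/orP; right; apply/bdP; split => //; exists y.
  move=> xAB [y [yH]]; rewrite in_setU negb_or => /andP[yA yB] exy.
  by case/orP: xAB => xX; apply/orP; [left|right];
     apply/bdP; split => //; exists y.
rewrite !in_setI => /andP[/bdP[]]; rewrite in_setI => /andP[xA xB] _.
case/bdP=> _ [y [yH]]; rewrite in_setU negb_or => /andP[yA yB] exy.
by apply/andP; split; apply/bdP; split => //; exists y.
Qed.

Lemma bd_setU1 X u : bd (u |: X) \subset u |: bd X.
Proof.
apply/subsetP => x /bdP[]; rewrite !in_setU1 => /orP[-> //|xX] [y []].
rewrite in_setU1 negb_or => yH /andP[_ yX] exy.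
by apply/orP; right; apply/bdP; split => //; exists y.
Qed.

End Boundary.
Arguments bdP {V e H X x}.

Lemma filter_eq_cat (T : Type) (a : pred T) s t1 t2 : filter a s = t1 ++ t2 ->
  exists s1 s2, [/\ s = s1 ++ s2, filter a s1 = t1 & filter a s2 = t2].
Proof.
elim: s t1 => [|x s IH] t1 /=; first by case: t1 t2 => [|? ?] [|? ?] //; exists [::], [::].
case: ifP => ax.
  case: t1 => [|y t1] /=.
    by move=> <-; exists [::], (x :: s); rewrite /= ax.
  case=> <- /IH[s1 [s2 [-> <- <-]]].
  by exists (x :: s1), s2; rewrite /= ax.
move=> /IH[s1 [s2 [-> <- <-]]].
by exists (x :: s1), s2; rewrite /= ax.
Qed.

Section Swept.
Variables (V : finType) (e : rel V) (n : nat).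
Implicit Types X Y Z : {set V}.
Let bdT := bd e [set: V].

(** For [X] the whole vertex set of a graph this is the vertex separation form of path-width less
    than [n]. *)
Definition swept X := exists s : seq V,
  [/\ uniq s, s =i X & forall a b, s = a ++ b -> #|bdT [set x in a]| < n].

Lemma swept0 : 0 < n -> swept set0.
Proof.
move=> n0; exists [::]; split => // [x|[|//] b _]; first by rewrite !inE.
rewrite (_ : bdT _ = set0) ?cards0//; apply/setP => x; rewrite in_set0.
by apply/negbTE/bdP => -[]; rewrite inE.
Qed.

Lemma swept_setU1 X u : swept X -> u \notin X -> #|bdT (u |: X)| < n ->
  swept (u |: X).
Proof.
move=> [s [us sX sn]] uX un; exists (rcons s u); split.
- by rewrite rcons_uniq us sX uX.
- by move=> x; rewrite mem_rcons !inE sX.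
move=> a b; case/lastP: b => [|b v].
  rewrite cats0 => <-; rewrite (_ : [set x in rcons s u] = u |: X)//.
  by apply/setP => x; rewrite !inE mem_rcons !inE sX.
by rewrite -rcons_cat => /rcons_inj[/sn].
Qed.

(** Restrict the enumeration of [Y] to [X]. The union of [X] with a prefix lies between [X] and [Y],
    hence has at least the boundary of [X]; by submodularity, intersecting the prefix with [X] does
    not enlarge its boundary. *)
Lemma swept_between X Y : swept Y -> X \subset Y ->
  (forall Z, X \subset Z -> Z \subset Y -> #|bdT X| <= #|bdT Z|) -> swept X.
Proof.
move=> [s [us sY sn]] XY Xmin; exists (filter (mem X) s); split.
- exact: filter_uniq.
- move=> x; rewrite mem_filter /= sY andb_idr //; exact: (subsetP XY).
move=> a b /filter_eq_cat[s1 [s2 [ss <- _]]].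
have := bd_submod e [set: V] X [set x in s1].
rewrite (_ : X :&: [set x in s1] = [set x in filter (mem X) s1]); last first.
  by apply/setP => x; rewrite !inE mem_filter.
have := sn _ _ ss; have : #|bdT X| <= #|bdT (X :|: [set x in s1])|.
  apply: Xmin; first exact: subsetUl.
  rewrite subUset XY; apply/subsetP => x; rewrite inE => xs1.
  by rewrite -sY ss mem_cat xs1.
rewrite -/bdT; lia.
Qed.

End Swept.

(** * Extending disjoint branch sets through equal boundaries *)

Section Branches.
Variables (G : graph) (I : finType).
Implicit Types (e : rel G) (X Y Z : {set G}) (S : {set I}).

Lemma connected_in1 (x : G) : connected_in [set x].
Proof.
split; first by exists x; rewrite inE.
by move=> y z; rewrite !inE => /eqP -> /eqP ->; exact: connect0.
Qed.

Lemma connected_in_setU1 (B : {set G}) u v :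
  connected_in B -> v \in B -> adj v u -> connected_in (u |: B).
Proof.
move=> [_ Bc] vB vu; split; first by exists u; rewrite setU11.
pose r := [rel a b | [&& a \in u |: B, b \in u |: B & adj a b]].
have rsym : connect_sym r.
  by apply: sym_connect_sym => a b; rewrite /= andbCA adj_sym.
have toB a : a \in B -> connect r v a.
  move=> aB; apply: (connect_sub _ (Bc _ _ vB aB)) => b c /= /and3P[bB cB bc].
  by apply: connect1; rewrite /= !inE bB cB bc !orbT.
have to a : a \in u |: B -> connect r v a.
  rewrite in_setU1 => /orP[/eqP ->|/toB//].
  by apply: connect1; rewrite /= !inE eqxx vB vu !orbT.
by move=> a b /to va /to vb; rewrite (connect_trans _ vb)// rsym.
Qed.

(* The branch sets being disjoint, [x a] is the only point of [D] in [B a]. *)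
Definition branches S X (B : I -> {set G}) (x : I -> G) (D : {set G}) : Prop :=
  [/\ forall a, a \in S -> connected_in (B a) /\ B a \subset X,
      forall a b, a \in S -> b \in S -> a != b -> [disjoint B a & B b],
      forall a, a \in S -> x a \in B a &
      D = [set x a | a in S]].

Lemma branches_setU1 S X B x D u a : branches S X B x D -> a \in S ->
    u \notin X -> adj (x a) u ->
  exists (B' : I -> {set G}) (x' : I -> G), (forall b, b \in S -> B b \subset B' b) /\
    branches S (u |: X) B' x' (u |: D :\ x a).
Proof.
move=> [BX Bdis xB ->] aS uX au.
have uB b : b \in S -> u \notin B b.
  by move=> bS; apply: contraNN uX; apply/subsetP; case: (BX _ bS).
exists (fun b => if b == a then u |: B b else B b), (fun b => if b == a then u else x b).
split; first by move=> b _; case: ifP => // _; exact: subsetUr.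
split.
- move=> b bS; have [cb sb] := BX _ bS; have [->|_] := eqVneq b a; split => //.
  + by have [ca _] := BX _ aS; apply: connected_in_setU1 au; rewrite ?xB.
  + by apply: setUS; case: (BX _ aS).
  + exact: subset_trans sb (subsetUr _ _).
- move=> b c bS cS bc; have := Bdis _ _ bS cS bc.
  rewrite -!setI_eq0 => /eqP BIC.
  have [bE|_] := eqVneq b a; have [cE|_] := eqVneq c a; rewrite ?BIC//.
  + by rewrite bE cE eqxx in bc.
  + by rewrite setIUl BIC setU0 setI_eq0 disjoints1; exact: uB.
  + by rewrite setIUr BIC setU0 setIC setI_eq0 disjoints1; exact: uB.
- by move=> b bS; case: ifP; rewrite ?setU11// => _; exact: xB.
have xinj b : b \in S -> (x b == x a) = (b == a).
  move=> bS; apply/eqP/eqP => [xba|->//]; apply/eqP; apply: contraT => ba.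
  have := Bdis _ _ bS aS ba; rewrite -setI_eq0 => /eqP/setP/(_ (x a)).
  by rewrite !inE xB// -xba xB.
apply/setP => y; rewrite !inE; apply/idP/imsetP => [|[b bS ->]].
  case/orP => [/eqP ->|/andP[ya /imsetP[b bS yb]]].
    by exists a => //; rewrite eqxx.
  by exists b => //; rewrite -xinj// -yb (negbTE ya).
case: ifP => [|ba]; first by rewrite eqxx.
by rewrite xinj// ba /= imset_f ?orbT.
Qed.

Let bdT e := bd e [set: G].

(* Menger's theorem in the form needed here.  If a proper intermediate set has a
   boundary of the same size, extend in two steps through it; otherwise deleting
   an arc from [X] to [Y :\: X] preserves the hypotheses.  The relation [e] is the
   remaining set of arcs. *)
Lemma branches_extend e S X Y B x : subrel e adj -> X \subset Y ->
    #|bdT e X| = #|bdT e Y| ->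
    (forall Z, X \subset Z -> Z \subset Y -> #|bdT e X| <= #|bdT e Z|) ->
    branches S X B x (bdT e X) ->
  exists (B' : I -> {set G}) (x' : I -> G), (forall a, a \in S -> B a \subset B' a) /\
    branches S Y B' x' (bdT e Y).
Proof.
have [m] := ubnP (#|[set p | e p.1 p.2]| + #|Y :\: X|).
elim: m => // m IH in e X Y B x *; rewrite ltnS => mP esub XY kXY kmin Bx.
have [[Z [XZ ZY kZ]]|noZ] := pselect (exists Z, [/\ X \proper Z, Z \proper Y &
    #|bdT e Z| = #|bdT e X|]).
  have [[XsZ [z1 z1Z z1X]] [ZsY [z2 z2Y z2Z]]] := (properP XZ, properP ZY).
  have [||||B1 [x1 [BB1 Bx1]]] := IH e X Z B x _ esub XsZ _ _ _.
  - apply: leq_trans mP; rewrite ltn_add2l proper_card//; apply/properP; split.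
      exact: setSD.
    by exists z2; rewrite !inE ?(negbTE z2Z) ?andbF// z2Y (contraNN _ z2Z)//; exact: subsetP.
  - by rewrite kZ.
  - by move=> W XW WZ; apply: kmin => //; exact: subset_trans ZsY.
  - by [].
  have [||||] := IH e Z Y B1 x1 _ esub ZsY _ _ _.
  - apply: leq_trans mP; rewrite ltn_add2l proper_card//; apply/properP; split.
      exact: setDS.
    by exists z1; rewrite !inE ?z1Z// z1X; exact: (subsetP ZsY).
  - by rewrite kZ.
  - by move=> W ZW WY; rewrite kZ kmin//; exact: subset_trans ZW.
  - by [].
  move=> B2 [x2 [BB2 Bx2]]; exists B2, x2; split => // a aS.
  exact: subset_trans (BB1 _ aS) (BB2 _ aS).
have kZ Z : X \proper Z -> Z \proper Y -> #|bdT e X| < #|bdT e Z|.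
  move=> XZ ZY; rewrite ltn_neqAle kmin ?proper_sub// andbT.
  by apply/negP => /eqP kZ; apply: noZ; exists Z.
have same D : D = bdT e X -> bdT e Y = D -> exists (B' : I -> {set G}) (x' : I -> G),
    (forall a, a \in S -> B a \subset B' a) /\ branches S Y B' x' (bdT e Y).
  move=> -> ->; exists B, x; split => //; case: Bx => B1 B2 B3 B4; split => //.
  by move=> a /B1[? BX]; split => //; exact: subset_trans BX XY.
(* Without an arc from [X] to the rest of [Y], the arcs leaving [X] also leave [Y], so the two
   boundaries, having equal size, coincide. *)
have [/existsP[[x0 u0] /= /and4P[x0X u0Y u0X e0]]|none] :=
  boolP [exists p : G * G, [&& p.1 \in X, p.2 \in Y, p.2 \notin X & e p.1 p.2]]; last first.
  apply: (same (bdT e X)) => //; apply/esym/eqP; rewrite eqEcard kXY leqnn andbT.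
  apply/subsetP => v /bdP[vX [y [_ yX vy]]]; apply/bdP; split.
    exact: (subsetP XY).
  exists y; split => //; apply: contraNN none => yY.
  by apply/existsP; exists (v, y); rewrite /= vX yY yX.
have [YE|YnE] := eqVneq Y (u0 |: X).
  have bdY : bdT e Y \subset u0 |: bdT e X by rewrite YE; exact: bd_setU1.
  have [bdXY|] := boolP (bdT e X \subset bdT e Y).
    by apply: (same (bdT e X)) => //; apply/esym/eqP; rewrite eqEcard bdXY kXY leqnn.
  (* The boundary vertex [x1] is lost only if [u0] was its sole neighbor outside [X]. Equality of
     sizes then makes [u0] replace [x1], and [u0] joins the branch set of [x1]. *)
  case/subsetPn => x1 x1X x1Y.
  have [x1XX [y [_ yX x1y]]] := bdP x1X.
  have yu : y = u0.
    apply/eqP; apply: contraNT x1Y => yu; apply/bdP; split; first by rewrite YE inE x1XX orbT.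
    by exists y; rewrite YE !inE negb_or yu yX.
  have DE : bdT e Y = u0 |: bdT e X :\ x1.
    apply/eqP; rewrite eqEcard; apply/andP; split.
      apply/subsetP => z zY; move/subsetP: bdY => /(_ _ zY); rewrite !inE.
      case/orP => [->//|->]; rewrite andbT; apply/orP; right.
      by apply: contraNneq x1Y => <-.
    by rewrite -kXY (cardsD1 x1 (bdT e X)) x1X cardsU1 leq_add2r leq_b1.
  case: (Bx) => _ _ _ xD; move: (x1X); rewrite xD => /imsetP[a aS x1a].
  rewrite DE x1a YE; apply: branches_setU1 => //.
  by apply: esub; rewrite -x1a -yu.
(* Deleting the arc from [x0] to [u0] can only remove [x0] from a boundary, and only for sets that
   do not contain [u0]. *)
pose e' : rel G := [rel u v | e u v && ((u, v) != (x0, u0))].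
have e'e Z : bdT e' Z \subset bdT e Z.
  apply/subsetP => z /bdP[zZ [y [_ yZ /andP[zy _]]]].
  by apply/bdP; split => //; exists y.
have ee' Z z : z \in bdT e Z -> (z != x0) || (u0 \in Z) -> z \in bdT e' Z.
  move=> /bdP[zZ [y [_ yZ zy]]] P; apply/bdP; split => //; exists y; split => //=.
  rewrite /e' /= zy xpair_eqE negb_and; case/orP: P => [->//|uZ].
  by apply/orP; right; apply: contraNneq yZ => ->.
have Xu : X \proper u0 |: X by apply: properUr; rewrite sub1set.
have uY : u0 |: X \proper Y.
  by rewrite properEneq eq_sym YnE subUset sub1set u0Y XY.
have bdY : bdT e' Y = bdT e Y.
  by apply/eqP; rewrite eqEsubset e'e; apply/subsetP => z /ee'; rewrite u0Y orbT; exact.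
have x0e : x0 \in bdT e X by apply/bdP; split => //; exists u0.
(* If [x0] dropped out of the boundary of [X], then [u0 |: X] would have a boundary no larger than
   that of [X], although it lies strictly between [X] and [Y]. *)
have bdX : bdT e' X = bdT e X.
  apply/eqP; rewrite eqEsubset e'e; apply/subsetP => z ze.
  have [zx|zx] := eqVneq z x0; last by apply: ee'; rewrite ?zx.
  apply: contraT => ze'; have := kZ _ Xu uY; rewrite ltnNge => /negP[].
  apply: (@leq_trans #|u0 |: bdT e' X|).
    apply/subset_leq_card/subsetP => v /bdP[]; rewrite !in_setU1.
    case/orP => [->//|vX] [y [_]]; rewrite in_setU1 negb_or => /andP[yu yX] vy.
    apply/orP; right; apply/bdP; split => //; exists y; split => //=.
    by rewrite /e' /= vy xpair_eqE negb_and yu orbT.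
  rewrite (cardsD1 x0 (bdT e X)) x0e cardsU1; apply: leq_add; first exact: leq_b1.
  apply/subset_leq_card/subsetP => v ve'; rewrite in_setD1 (subsetP (e'e _) _ ve').
  by rewrite andbT; apply: contraNneq ze' => vx; rewrite zx -vx.
have [] := IH e' X Y B x _ _ XY => //.
- apply: leq_trans mP; rewrite ltn_add2r proper_card//; apply/properP; split.
    by apply/subsetP => -[u v]; rewrite !inE => /andP[].
  by exists (x0, u0); rewrite inE /e' /= ?e0// xpair_eqE !eqxx andbF.
- by move=> u v /andP[/esub].
- by rewrite bdX bdY.
(* Strictly intermediate sets have a strictly larger boundary and can afford the loss of [x0]. *)
- move=> Z XZ ZY; rewrite bdX.
  have [<-|XnZ] := eqVneq X Z; first by rewrite bdX.
  have [->|ZnY] := eqVneq Z Y; first by rewrite bdY kXY.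
  have := kZ Z; rewrite !properEneq XnZ XZ ZnY ZY => /(_ isT isT) lt.
  rewrite -ltnS; apply: leq_trans lt _; rewrite (cardsD1 x0 (bdT e Z)) -add1n.
  apply: leq_add; first exact: leq_b1.
  by apply/subset_leq_card/subsetP => z; rewrite in_setD1 => /andP[zx /ee'->]//; rewrite zx.
- by rewrite bdX.
- by move=> B' [x' HB]; exists B', x'; rewrite -bdY.
Qed.

End Branches.

Lemma path_cross (T : eqType) (e : rel T) (S : pred T) x p :
    path e x p -> S x -> ~~ S (last x p) ->
  exists a b, [/\ a \in x :: p, b \in p, S a, ~~ S b & e a b].
Proof.
elim: p x => [|y p IH] x /=; first by move=> _ ->.
case/andP=> xy yp Sx Sl; have [Sy|Sy] := boolP (S y); last first.
  by exists x, y; rewrite !mem_head.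
have [a [b [ap bp Sa Sb ab]]] := IH _ yp Sy Sl.
by exists a, b; split; rewrite // inE ?ap ?bp orbT.
Qed.

(** * Growing a model of a tree *)

Section TreeOrder.
Variable T : graph.
Hypothesis hT : is_tree T.

(** Two distinct neighbors of [u] in [S] would be joined by a simple path inside [S], which closes
    up to a cycle through [u]. *)
Lemma tree_unique_neighbor (S : {set T}) u : connected_in S -> u \notin S ->
  {in S &, forall v w, adj u v -> adj u w -> v = w}.
Proof.
move=> [_ Sc] uS v w vS wS uv uw; apply/eqP; apply: contraT => vw.
case/connectP: (Sc _ _ vS wS) => p0 /shortenP[p pp up _] wE.
have pS : {subset v :: p <= S}.
  move: (v) vS pp => v0 v0S; elim: p v0 v0S {up wE} => [|y p IH] v0 v0S /=.
    by move=> _ y; rewrite inE => /eqP ->.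
  by case/andP=> /and3P[_ yS _] /(IH _ yS) H z; rewrite inE => /orP[/eqP ->|/H].
case: hT => _ /(_ (u :: v :: p)); case.
  by case: p wE vw {pp up pS} => //= wE; rewrite wE eqxx.
apply/andP; split; last first.
  by rewrite cons_uniq up andbT; apply: contraNN uS => /pS.
rewrite /= uv rcons_path -wE adj_sym uw andbT.
by apply: sub_path pp => a b /and3P[].
Qed.

(** Add vertices one at a time while keeping the set connected; [tree_unique_neighbor] then leaves
    each new vertex a single earlier neighbor. *)
Lemma tree_order : exists s : seq T, [/\ uniq s, forall x, x \in s &
  forall a u b, s = a ++ u :: b ->
    {in a &, forall v w, adj u v -> adj u w -> v = w}].
Proof.
case: (hT) => -[[r _] Tc] _.
have T0 : (0 < #|T|)%N by apply/card_gt0P; exists r.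
suff [s [us ss _ so]] : exists s : seq T, [/\ uniq s, size s = #|T|.-1.+1,
    connected_in [set x in s] & forall a u b, s = a ++ u :: b ->
    {in a &, forall v w, adj u v -> adj u w -> v = w}].
  exists s; split => // x.
  suff sE : [set x in s] = [set: T] by have := in_setT x; rewrite -sE inE.
  by apply/eqP; rewrite eqEcard subsetT cardsT cardsE (card_uniqP us) ss prednK ?leqnn.
move: (leqnn #|T|.-1); elim: {1 3}#|T|.-1 => [_|k IH kT].
  exists [:: r]; split => //.
    rewrite (_ : [set x in [:: r]] = [set r]); first exact: connected_in1.
    by apply/setP => x; rewrite !inE.
  by move=> [|? [|//]] u [|? ?] //.
have [s [us ss sc so]] := IH (ltnW kT).
have [u us'] : exists u, u \notin s.
  apply/existsP; rewrite -negb_forall; apply: contraL kT => /forallP sT.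
  rewrite -leqNgt -ltnS -ss prednK//; apply: leq_trans (card_size s).
  by rewrite -cardsT; apply/subset_leq_card/subsetP => x _; exact: sT.
have [v vs] : exists v, v \in s by case: s ss {us sc so us'} => // v s; exists v; rewrite mem_head.
have /connectP[p pp pl] := Tc v u (in_setT _) (in_setT _).
have [|a [b [_ _ as' bs ab]]] := path_cross (S := mem s) pp vs; first by rewrite -pl.
have {}ab : adj a b by case/and3P: ab.
exists (rcons s b); split.
- by rewrite rcons_uniq us andbT.
- by rewrite size_rcons ss.
- rewrite (_ : [set x in rcons s b] = b |: [set x in s]).
    by apply: connected_in_setU1 ab => //; rewrite inE.
  by apply/setP => x; rewrite !inE mem_rcons inE.
move=> a' u' b'; case/lastP: b' => [|b' z].
  rewrite cats1 => /rcons_inj[<- <-] x y xs ys.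
  by apply: (tree_unique_neighbor sc); rewrite inE.
by rewrite -rcons_cons -rcons_cat => /rcons_inj[/so].
Qed.

End TreeOrder.

Lemma tree_minor_free_swept (T G : graph) : is_tree T -> ~ is_minor T G ->
  swept (@adj G) #|T| [set: G].
Proof.
move=> hT noT; have [s [us sT so]] := tree_order hT.
have sizes : size s = #|T|.
  by rewrite -(card_uniqP us); apply: eq_card => x; rewrite sT.
have [//|nV] := pselect (swept (@adj G) #|T| [set: G]).
exfalso; apply: noT.
pose bdT := bd (@adj G) [set: G].
pose joined (a : seq T) (B : T -> {set G}) :=
  {in a &, forall t u, adj t u -> exists y z, [/\ y \in B t, z \in B u & adj y z]}.
(* Invariant for an initial segment [a] of the tree: [X] is a maximal swept set among those with
   boundary at most [size a], and each branch set of the partial model contains exactly one vertex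
   of its boundary. *)
pose state a := exists X (B : T -> {set G}) (x : T -> G),
  [/\ swept (@adj G) #|T| X,
      forall Y, swept (@adj G) #|T| Y -> X \proper Y -> (size a < #|bdT Y|)%N,
      branches [set t in a] X B x (bdT X), (#|bdT X| <= size a)%N & joined a B].
have maxi X k : swept (@adj G) #|T| X -> (#|bdT X| <= k)%N ->
    exists Y, [/\ swept (@adj G) #|T| Y, X \subset Y, (#|bdT Y| <= k)%N &
    forall Z, swept (@adj G) #|T| Z -> Y \proper Z -> (k < #|bdT Z|)%N].
  move=> Xs Xk.
  pose P Y := `[< swept (@adj G) #|T| Y /\ X \subset Y /\ (#|bdT Y| <= k)%N >].
  have PX : P X by apply/asboolP.
  case: (arg_maxnP (fun Y : {set G} => #|Y|) PX) => Y /asboolP[Ys [XY Yk]] Ymax.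
  exists Y; split => // Z Zs YZ; rewrite ltnNge; apply/negP => Zk.
  have /Ymax : P Z.
    by apply/asboolP; split => //; split => //; exact: subset_trans (proper_sub YZ).
  by move=> ZY; have := leq_trans (proper_card YZ) ZY; rewrite ltnn.
have T0 : (0 < #|T|)%N.
  by case: hT => -[[t _] _] _; apply/card_gt0P; exists t.
(* The next tree vertex [u] gets the branch set [[set y]], where [y] lies outside [X] next to the
   boundary vertex of the only earlier neighbor of [u]. If there is no such neighbor, any vertex
   outside [X] will do, and one exists since the whole graph is not swept. *)
have grow a u b : s = a ++ u :: b -> state a -> exists X y (B : T -> {set G}) (x : T -> G),
    [/\ swept (@adj G) #|T| X,
     forall Y, swept (@adj G) #|T| Y -> X \proper Y -> (size a < #|bdT Y|)%N,
     (#|bdT X| <= size a)%N, y \notin X &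
     branches [set t in rcons a u] (y |: X) B x (y |: bdT X) /\ joined (rcons a u) B].
  move=> sE [X [B [x [Xs Xmax [B1 B2 B3 B4] Xk Bj]]]].
  have ua : u \notin a.
    by move: us; rewrite sE cat_uniq => /and3P[_]; rewrite /= negb_or => /andP[].
  have [y [yX yadj]] : exists y, y \notin X /\ {in a, forall v, adj u v -> adj (x v) y}.
    have [/hasP[v va uv]|/hasPn none] := boolP (has (adj u) a).
      have /bdP[_ [y [_ yX vy]]] : x v \in bdT X by rewrite B4 imset_f// inE.
      by exists y; split => // w wa uw; rewrite (so _ _ _ sE w v).
    have /subsetPn[y _ yX] : ~~ ([set: G] \subset X).
      by apply: contra_notN nV; rewrite subTset => /eqP <-.
    by exists y; split => // w /none/negP.
  have neu t : t \in a -> (t == u) = false by move=> ta; apply: contraNF ua => /eqP <-.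
  exists X, y, (fun t => if t == u then [set y] else B t),
    (fun t => if t == u then y else x t); split => //; split.
    split.
    - move=> t; rewrite inE mem_rcons inE; have [_ _|_ /= ta] := eqVneq t u.
        by split; [exact: connected_in1|rewrite sub1set setU11].
      have [|tc tX] := B1 t; first by rewrite inE.
      by split => //; exact: subset_trans (subsetUr _ _).
    - move=> t t'; rewrite !inE !mem_rcons !inE.
      have yB w : w \in a -> y \notin B w.
        move=> wa; apply: contraNN yX; apply/subsetP.
        by case: (B1 w) => //; rewrite inE.
      have [->|_] := eqVneq t u; have [->|_] /= := eqVneq t' u.
      + by move=> _ _ /eqP.
      + by move=> _ ta _; rewrite disjoints1; exact: yB.
      + by move=> ta _ _; rewrite disjoint_sym disjoints1; exact: yB.
      + by move=> ta ta'; apply: B2; rewrite inE.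
    - move=> t; rewrite inE mem_rcons inE; have [_ _|_ /= ta] := eqVneq t u.
        by rewrite inE.
      by apply: B3; rewrite inE.
    - apply/setP => z; rewrite B4 in_setU1; apply/orP/imsetP.
        move=> [/eqP ->|/imsetP[t]].
          by exists u; rewrite ?inE ?mem_rcons ?mem_head// eqxx.
        rewrite inE => ta ->; exists t; last by rewrite neu.
        by rewrite inE mem_rcons inE ta orbT.
      move=> [t]; rewrite inE mem_rcons inE => /orP[tu ->|ta ->].
        by rewrite tu; left.
      by rewrite neu//; right; rewrite imset_f// inE.
  have ux v : v \in a -> adj u v -> exists2 z, z \in B v & adj y z.
    move=> va uv; exists (x v); last by rewrite adj_sym yadj.
    by apply: B3; rewrite inE.
  move=> t t'; rewrite !mem_rcons !inE.
  have [->|_] := eqVneq t u; have [->|_] /= := eqVneq t' u.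
  - by rewrite adj_irr.
  - move=> _ ta tt'; have [z zB yz] := ux _ ta tt'.
    by exists y, z; rewrite inE eqxx.
  - move=> ta _; rewrite adj_sym => tt'; have [z zB yz] := ux _ ta tt'.
    by exists z, y; rewrite inE eqxx adj_sym.
  - exact: Bj.
have all_states a b : s = a ++ b -> (size a < #|T|)%N -> state a.
  elim/last_ind: a b => [|a u IH] b.
    move=> _ _; have [||Y [Ys _ Yk Ymax]] := maxi set0 0.
    - exact: swept0.
    - rewrite leqn0 cards_eq0; apply/eqP/setP => z; rewrite in_set0.
      by apply/negbTE/bdP => -[]; rewrite inE.
    - have Y0 : bdT Y = set0 by apply/eqP; rewrite -cards_eq0 -leqn0.
      have /subsetPn[y0 _ _] : ~~ ([set: G] \subset set0).
        by apply: contra_notN nV; rewrite subset0 => /eqP ->; exact: swept0.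
      exists Y, (fun=> set0), (fun=> y0); rewrite Y0 cards0; split => //.
      split => //; try by move=> ?; rewrite inE.
      by apply/setP => z; rewrite in_set0; apply/esym/negbTE/imsetP => -[t]; rewrite inE.
  rewrite cat_rcons size_rcons => sE sa.
  have [X [y [B [x [Xs Xmax Xk yX [Bx Bj]]]]]] := grow _ _ _ sE (IH _ sE (ltnW sa)).
  have bdX' : (#|bdT (y |: X)| <= (size a).+1)%N.
    apply: leq_trans (subset_leq_card (bd_setU1 _ _ _ _)) _.
    by rewrite cardsU1 (leq_add (leq_b1 _) Xk).
  have X's : swept (@adj G) #|T| (y |: X).
    by apply: swept_setU1 => //; exact: leq_trans sa.
  have XX' : X \proper y |: X by apply: properUr; rewrite sub1set.
  (* By maximality of [X], adding [y] must enlarge the boundary, so that no old boundary vertex is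
     lost. *)
  have bdX'E : bdT (y |: X) = y |: bdT X.
    apply/eqP; rewrite eqEcard bd_setU1 cardsU1.
    by apply: leq_trans (Xmax _ X's XX'); rewrite (leq_add (leq_b1 _) Xk).
  have [Y [Ys X'Y Yk Ymax]] := maxi _ _ X's bdX'.
  have XY : X \proper Y := proper_sub_trans XX' X'Y.
  have bdX'k : #|bdT (y |: X)| = (size a).+1.
    by apply/eqP; rewrite eqn_leq bdX' Xmax.
  have bdYk : #|bdT Y| = (size a).+1 by apply/eqP; rewrite eqn_leq Yk Xmax.
  (* A set of minimal boundary between [y |: X] and [Y] is swept by [swept_between], so maximality
     of [X] bounds its boundary from below. This is the minimality assumption of
     [branches_extend]. *)
  have btw (Z : {set G}) : y |: X \subset Z -> Z \subset Y -> (#|bdT (y |: X)| <= #|bdT Z|)%N.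
    move=> XZ ZY; pose P (W : {set G}) := (y |: X \subset W) && (W \subset Y).
    have PX : P (y |: X) by rewrite /P subxx.
    case: (arg_minnP (fun W : {set G} => #|bdT W|) PX) => W /andP[XW WY] Wmin.
    apply: (@leq_trans #|bdT W|); last by apply: Wmin; rewrite /P XZ.
    rewrite bdX'k; apply: Xmax; last exact: proper_sub_trans XW.
    apply: swept_between Ys WY _ => W' WW' W'Y; apply: Wmin.
    by rewrite /P W'Y (subset_trans XW).
  rewrite -bdX'E in Bx.
  have [||B' [x' [BB' Bx']]] := branches_extend _ X'Y _ btw Bx; rewrite ?bdX'k//.
  exists Y, B', x'; split => //; rewrite ?size_rcons ?bdYk//.
  move=> t u' tr ur tu; have [z [z' [zB zB' zz']]] := Bj _ _ tr ur tu.
  exists z, z'; split => //; first by apply: (subsetP (BB' _ _)); rewrite // inE.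
  by apply: (subsetP (BB' _ _)); rewrite // inE.
(* For the last tree vertex [grow] alone completes the model; [y |: X] might have too large a
   boundary to be swept. *)
case/lastP: s us sT so sizes grow all_states => [|a u] us sT so sizes grow all_states.
  by rewrite -sizes in T0.
have [] := grow a u [::].
- by rewrite cats1.
- by apply: (all_states a [:: u]); rewrite ?cats1// -sizes size_rcons.
move=> X [y [B [x [_ _ _ _ [[B1 B2 _ _] Bj]]]]].
exists B; split.
- by move=> t; case: (B1 t) => //; rewrite inE sT.
- by move=> t t' tt'; apply: B2; rewrite ?inE ?sT.
- by move=> t t'; apply: Bj; rewrite sT.
Qed.

Local Open Scope ring_scope.

(** * Cut families *)

Section Span.
Variables (R : realType) (V : finType) (d : V -> V -> R).
Implicit Types (A B C S : {set V}) (a b : R).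

(* [connects C c]: the points of [C] can be connected to each other at total cost
   at most [c], auxiliary points being allowed. *)
Inductive connects : {set V} -> R -> Prop :=
| connects_pair x y : connects [set x; y] (d x y)
| connects_union A B a b : A :&: B != set0 -> connects A a -> connects B b ->
    connects (A :|: B) (a + b)
| connects_sub A B a b : A \subset B -> b <= a -> connects B b -> connects A a.

Hypothesis dm : is_metric d.

Lemma metric_refl x : d x x = 0.
Proof. by case: dm => d0 _ _; exact/d0. Qed.

Lemma metric_sym x y : d x y = d y x.
Proof. by case: dm. Qed.

Lemma metric_triangle x y z : d x z <= d x y + d y z.
Proof. by case: dm. Qed.

Lemma metric_ge0 x y : 0 <= d x y.
Proof.
by have := metric_triangle x y x; rewrite metric_refl (metric_sym y); lra.
Qed.

Lemma metric_gt0 x y : x != y -> 0 < d x y.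
Proof.
move=> xy; rewrite lt0r metric_ge0 andbT; apply: contraNneq xy.
by case: dm => d0 _ _ /d0 ->.
Qed.

Lemma seq_length_cat (x : V) s t :
  seq_length d x (s ++ t) = seq_length d x s + seq_length d (last x s) t.
Proof.
elim: s x => [|y s IH] x /=; first by rewrite /seq_length big_nil add0r.
by rewrite !seq_length_cons IH addrA.
Qed.

Lemma seq_length_nil (x : V) : seq_length d x [::] = 0.
Proof. by rewrite /seq_length big_nil. Qed.

Lemma seq_length_ge_dist (x : V) s : d x (last x s) <= seq_length d x s.
Proof.
elim: s x => [|y s IH] x /=; first by rewrite seq_length_nil metric_refl.
by rewrite seq_length_cons; apply: le_trans (metric_triangle x y _) _; rewrite lerD2l.
Qed.

Lemma seq_length_ge0 (x : V) s : 0 <= seq_length d x s.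
Proof. exact: le_trans (metric_ge0 _ _) (seq_length_ge_dist x s). Qed.

Lemma connects1 x c : 0 <= c -> connects [set x] c.
Proof.
by move=> c0; apply: connects_sub (connects_pair x x); rewrite ?metric_refl// sub1set !inE eqxx.
Qed.

(** Walking twice along each link gives a closed tour; for a union, the tour of one part is inserted
    into the other at a common point. *)
Lemma connects_closed_walk C c : connects C c -> forall x, x \in C -> exists s,
  [/\ last x s = x, {subset C <= x :: s} & seq_length d x s <= 2 * c].
Proof.
elim=> [x y|A B a b|A B a b AB ab _ IH] {C c}; last 2 first.
- have U A' B' a' b' x : A' :&: B' != set0 -> x \in A' ->
      (forall x, x \in A' -> exists s,
        [/\ last x s = x, {subset A' <= x :: s} & seq_length d x s <= 2 * a']) ->
      (forall x, x \in B' -> exists s,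
        [/\ last x s = x, {subset B' <= x :: s} & seq_length d x s <= 2 * b']) ->
    exists s, [/\ last x s = x, {subset A' :|: B' <= x :: s} &
      seq_length d x s <= 2 * (a' + b')].
    move=> /set0Pn[z]; rewrite inE => /andP[zA zB] xA /(_ _ xA)[s [sx sA sa]].
    move=> /(_ _ zB)[t [tz tB tb]].
    have zs := sA _ zA; case/splitPl: zs sx sA sa => s1 s2 s1z sx sA sa.
    exists (s1 ++ t ++ s2); split.
    - by move: sx; rewrite !last_cat s1z tz.
    - move=> y; rewrite inE => /orP[/sA|/tB]; rewrite !inE !mem_cat.
        by case/or3P=> ->; rewrite ?orbT.
      case/orP => [/eqP ->|->]; rewrite ?orbT//.
      by have := mem_last x s1; rewrite s1z inE => /orP[]->; rewrite ?orbT.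
    - move: sa; rewrite !seq_length_cat s1z tz => sa; lra.
  move=> AB _ IHA _ IHB x; rewrite inE => /orP[] xX; first exact: U xX IHA IHB.
  have [|s [s1 s2 s3]] := U _ _ b a x _ xX IHB IHA; first by rewrite setIC.
  by exists s; split => //; [move=> y; rewrite setUC; exact: s2|rewrite addrC].
- move=> x /(subsetP AB)/IH[s [sx sB sl]]; exists s; split => //.
    by move=> y /(subsetP AB)/sB.
  by apply: le_trans sl _; rewrite ler_pM2l.
move=> z; rewrite !inE => zxy.
wlog -> : x y {zxy} / z = x.
  case/orP: zxy => /eqP -> H; first exact: H.
  by have [s] := H y x erefl; rewrite setUC metric_sym; exists s.
exists [:: y; x]; split => //=.
  by move=> w; rewrite !inE => /orP[] ->; rewrite ?orbT.
by rewrite !seq_length_cons seq_length_nil (metric_sym y); lra.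
Qed.

(** A closed tour from [x] costs at most [2 * c]. It passes through [y], so a final move from [x] to
    [y] costs at most [2 * c] more. *)
Lemma connects_tsp x y C c : connects C c -> x \in C -> y \in C -> tsp d x C y <= 4 * c.
Proof.
move=> Cc xC yC; have [s [sx sC sc]] := connects_closed_walk Cc xC.
have [_ tmin] := tsp_minimum dm x C y.
have : tour_lengths d x C y (seq_length d x (rcons s y)).
  exists (rcons s y); split; rewrite ?last_rcons// => z /sC.
  by rewrite !inE mem_rcons inE => /orP[] ->; rewrite ?orbT.
move/tmin => /le_trans; apply.
rewrite -cats1 seq_length_cat sx seq_length_cons seq_length_nil addr0.
suff : d x y <= seq_length d x s by lra.
have /splitPl ys := sC _ yC; case: ys => s1 s2 s1y.
rewrite seq_length_cat -s1y; apply: le_trans (seq_length_ge_dist x s1) _.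
by rewrite lerDl seq_length_ge0.
Qed.

Lemma connects_bigU (I : Type) (r : seq I) (P : pred I) A a (B : I -> {set V}) (b : I -> R) :
  connects A a -> (forall i, P i -> connects (B i) (b i) /\ A :&: B i != set0) ->
  connects (A :|: \bigcup_(i <- r | P i) B i) (a + \sum_(i <- r | P i) b i).
Proof.
move=> Aa H; elim: r => [|i r IH]; first by rewrite !big_nil setU0 addr0.
rewrite !big_cons; case: ifP => // /H[Bi ABi].
rewrite setUCA addrCA [X in connects X _]setUC [X in connects _ X]addrC; apply: connects_union => //.
apply: contraNneq ABi; rewrite setIUl => /eqP.
by rewrite setU_eq0 => /andP[].
Qed.

End Span.

(** * Weighted families of cuts *)

Section Cuts.
Variables (R : realType) (V : finType).
Implicit Types (s : seq (R * {set V})) (E : pred {set V}) (C S : {set V}).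

Definition cutsum s E : R := \sum_(c <- s | E c.2) c.1.

Definition separates (u v : V) : pred {set V} := fun S => (u \in S) != (v \in S).
Definition meets C : pred {set V} := fun S => S :&: C != set0.
Definition splits C : pred {set V} := fun S => (S :&: C != set0) && ~~ (C \subset S).

Definition nonneg s := forall c, c \in s -> 0 <= c.1.

Lemma cutsum_ge0 s E : nonneg s -> 0 <= cutsum s E.
Proof.
by move=> s0; rewrite /cutsum big_seq_cond sumr_ge0// => c /andP[/s0].
Qed.

Lemma cutsum_le s (E1 E2 : pred {set V}) : nonneg s ->
  (forall c, c \in s -> E1 c.2 -> E2 c.2) -> cutsum s E1 <= cutsum s E2.
Proof.
move=> s0 E12; rewrite /cutsum big_mkcond [leRHS]big_mkcond big_seq [leRHS]big_seq ler_sum// => c cs.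
 case: ifP => [/(E12 _ cs) ->//|_].
by case: ifP => // _; exact: s0.
Qed.

Lemma cutsum_leU s (E E1 E2 : pred {set V}) : nonneg s ->
  (forall c, c \in s -> E c.2 -> E1 c.2 || E2 c.2) ->
  cutsum s E <= cutsum s E1 + cutsum s E2.
Proof.
move=> s0 E12; rewrite /cutsum big_mkcond [X in _ <= X + _]big_mkcond
  [X in _ <= _ + X]big_mkcond -big_split big_seq [leRHS]big_seq ler_sum// => c cs /=.
have c0 := s0 _ cs; case: ifP => [/(E12 _ cs)|_].
  by case: ifP; case: ifP => //=; rewrite ?lerDl ?lerDr// ?addr0 ?add0r.
by case: ifP; case: ifP; rewrite ?addr0 ?add0r ?addr_ge0.
Qed.

Lemma cutsum0 s E : (forall c, c \in s -> ~~ E c.2) -> cutsum s E = 0.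
Proof. by move=> H; rewrite /cutsum big_seq_cond big1// => c /andP[/H/negbTE ->]. Qed.

Lemma cutsum_eq s (E1 E2 : pred {set V}) :
  (forall c, c \in s -> E1 c.2 = E2 c.2) -> cutsum s E1 = cutsum s E2.
Proof.
move=> H; rewrite /cutsum big_seq_cond [RHS]big_seq_cond; apply: eq_bigl => c.
by case: (boolP (c \in s)) => //= /H.
Qed.

Lemma cutsum_cat s t E : cutsum (s ++ t) E = cutsum s E + cutsum t E.
Proof. by rewrite /cutsum big_cat. Qed.

Lemma cutsum_flatten (I : Type) (r : seq I) (f : I -> seq (R * {set V})) E :
  cutsum (flatten [seq f i | i <- r]) E = \sum_(i <- r) cutsum (f i) E.
Proof.
elim: r => [|i r IH] /=; first by rewrite /cutsum !big_nil.
by rewrite cutsum_cat IH big_cons.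
Qed.

(* The apex [o] counts as lying outside of every cut, even when it is a point of
   [H]: a cut splits [o |: C] when it meets [C]. *)
Definition captures (d : V -> V -> R) (H : {set V}) (o : V) s : Prop :=
  [/\ nonneg s, forall c, c \in s -> c.2 \subset H,
      forall C, C \subset H -> C != set0 -> connects d C (cutsum s (splits C)) &
      forall C, C \subset H -> connects d (o |: C) (cutsum s (meets C))].

End Cuts.

(** Provides a mesh [1 / N] finer than finitely many positive quantities: take [N] above the sum of
    their inverses. *)
Lemma exists_scale (R : realType) (I : finType) (P : pred I) (f : I -> R) :
    (forall i, P i -> 0 < f i) ->
  exists N : nat, (0 < N)%N /\ forall i, P i -> 1 <= N%:R * f i.
Proof.
move=> f0; exists (Num.truncn (\sum_(i | P i) (f i)^-1)).+1; split => // i Pi.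
rewrite -ler_pdivrMr ?f0// mul1r; apply: le_trans (ltW (truncnS_gt _)).
by rewrite (bigD1 i)//= lerDl sumr_ge0// => j /andP[/f0 fj _]; rewrite invr_ge0 ltW.
Qed.

Lemma count_iota_itv a b Y :
  (b <= Y)%N -> count (fun y => a <= y < b)%N (iota 0 Y) = (b - a)%N.
Proof.
move=> bY; transitivity (minn b Y - a)%N; last by rewrite (minn_idPl bY).
elim: Y {bY} => [|Y IH]; first by rewrite minn0.
rewrite -addn1 iotaD count_cat IH /= add0n addn0.
case: leqP => ?; case: ltnP => ? /=; lia.
Qed.

Lemma count_disjointU (T : Type) (p q r : pred T) s :
  (forall y, ~~ (p y && q y)) -> (forall y, p y || q y -> r y) ->
  (count p s + count q s <= count r s)%N.
Proof.
move=> pq pqr; rewrite -count_predUI (_ : count (predI p q) s = 0%N).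
  by rewrite addn0; exact: sub_count.
by elim: s => //= x s ->; rewrite (negbTE (pq x)).
Qed.

Lemma set_argmax (V : finType) (X : V -> nat) (C : {set V}) : C != set0 ->
  exists2 c, c \in C & forall c', c' \in C -> (X c' <= X c)%N.
Proof. by case/set0Pn => c1 c1C; case: (arg_maxnP X c1C) => c cC cmax; exists c. Qed.

Lemma set_argmin (V : finType) (X : V -> nat) (C : {set V}) : C != set0 ->
  exists2 c, c \in C & forall c', c' \in C -> (X c <= X c')%N.
Proof. by case/set0Pn => c1 c1C; case: (arg_minnP X c1C) => c cC cmin; exists c. Qed.

Lemma set_ind_max (V : finType) (X : V -> nat) (Q : {set V} -> Prop) :
    Q set0 ->
    (forall c (C : {set V}), (forall c', c' \in C -> (X c' <= X c)%N) -> c \notin C ->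
      Q C -> Q (c |: C)) ->
  forall C, Q C.
Proof.
move=> Q0 QU C; have [n] := ubnP #|C|; elim: n C => // n IH C /ltnSE Cn.
have [->//|/(set_argmax X)[c cC cmax]] := eqVneq C set0.
rewrite -(setD1K cC); apply: QU; rewrite ?setD11//.
  by move=> c'; rewrite in_setD1 => /andP[_ /cmax].
by apply: IH; move: Cn; rewrite (cardsD1 c) cC.
Qed.

(** * Cuts along a line *)

Section Line.
Variables (R : realType) (V : finType) (d : V -> V -> R).
Hypothesis dm : is_metric d.

(* The cuts are the windows of length [tau] of the line [g @: P], discretized with
   mesh [1 / N].  The windows meeting [C] have measure [tau] plus the sum over
   consecutive points of [C] of the minimum of [tau] and their gap. *)
Lemma line_cuts (P : {set V}) (g : V -> R) o (tau : R) : 0 < tau ->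
    {in P, forall x, 0 <= g x} ->
    {in P &, forall x y, d x y <= `|g x - g y|} ->
    {in P, forall x, d o x <= tau} ->
  exists s : seq (R * {set V}),
    [/\ captures d P o s,
        {in P &, forall x y, cutsum s (separates x y) <= 8 * `|g x - g y|} &
        {in P, forall x, cutsum s (fun S : {set V} => x \in S) <= 4 * tau}].
Proof.
move=> tau0 g0 dg otau.
(* With this mesh, distinct points of [P] round to distinct integers, and rounding changes gaps and
   [tau] by bounded factors only. *)
have [N [N0 Ngap Ntau]] : exists N : nat, [/\ 0 < N%:R :> R,
    forall x y, x \in P -> y \in P -> x != y -> 1 <= N%:R * `|g x - g y| &
    1 <= N%:R * tau].
  have [|N [N0 hN]] := @exists_scale R (option (V * V))
      (fun p => if p is Some p then [&& p.1 \in P, p.2 \in P & p.1 != p.2] else true)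
      (fun p => if p is Some p then `|g p.1 - g p.2| else tau).
    move=> [[x y] /and3P[/= xP yP xy]|//].
    by apply: lt_le_trans (dg _ _ xP yP); exact: metric_gt0.
  exists N; split; rewrite ?ltr0n//; last exact: (hN None).
  by move=> x y xP yP xy; apply: (hN (Some (x, y))); rewrite /= xP yP.
have [X Xg] : {X : V -> nat |
    forall x, x \in P -> (X x)%:R <= N%:R * g x < (X x).+1%:R}.
  exists (fun x => Num.truncn (N%:R * g x)) => x xP.
  by apply: truncn_itv; rewrite mulr_ge0 ?g0// ltW.
have [T [T1 T2]] : exists T : nat, N%:R * tau <= T%:R /\ T%:R <= 2 * (N%:R * tau).
  exists (Num.truncn (N%:R * tau)).+1; split; first exact/ltW/truncnS_gt.
  have /andP[] : (Num.truncn (N%:R * tau))%:R <= N%:R * tau < (Num.truncn (N%:R * tau)).+1%:R.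
    by apply: truncn_itv; apply: le_trans Ntau.
  rewrite -natr1; move: (N%:R * tau) ((Num.truncn _)%:R : R) Ntau => a b ? ? ?; lra.
pose Y := (\max_(x in P) X x + T)%N.
have XY x : x \in P -> (X x + T <= Y)%N.
  by move=> xP; rewrite leq_add2r; exact: leq_bigmax_cond.
pose W y := [set x in P | X x <= y < X x + T]%N.
(* The factor 2 pays for rounding: a gap of [k > 0] cells may come from a distance close to
   [(k + 1) / N]. *)
pose s : seq (R * {set V}) := [seq (2 / N%:R, W y) | y <- iota 0 Y].
have sE E : cutsum s E = 2 / N%:R * (count (E \o W) (iota 0 Y))%:R.
  by rewrite /cutsum big_map /= big_const_seq iter_addr_0 mulr_natr.
have k0 : 0 < 2 / N%:R :> R by rewrite divr_gt0.
have Xinj x y : x \in P -> y \in P -> X x = X y -> x = y.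
  move=> xP yP XE; apply/eqP; apply: contraT => /(Ngap _ _ xP yP).
  have := Xg _ xP; have := Xg _ yP; rewrite XE -natr1.
  move=> /andP[a1 a2] /andP[a3 a4].
  have : `|N%:R * g x - N%:R * g y| < 1 by rewrite ltr_norml; apply/andP; split; lra.
  by rewrite -mulrBr normrM (gtr0_norm N0) => ? ?; lra.
have gapX x y : x \in P -> y \in P -> (X x <= X y)%N ->
    d x y <= 2 / N%:R * (X y - X x)%:R.
  move=> xP yP xy; have [->|nxy] := eqVneq x y.
    by rewrite metric_refl// subnn mulr0.
  have lt : (X x < X y)%N.
    by rewrite ltn_neqAle xy andbT; apply: contraNneq nxy => /Xinj ->.
  apply: le_trans (dg _ _ xP yP) _.
  have := Xg _ xP; have := Xg _ yP; rewrite -!natr1 natrB//.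
  move=> /andP[a1 a2] /andP[a3 a4].
  have lt' : (X x)%:R + 1 <= (X y)%:R :> R by rewrite natr1 ler_nat.
  rewrite mulrAC -ler_pdivrMr ?invr_gt0// invrK.
  rewrite mulrC -{1}(gtr0_norm N0) -normrM ler_norml mulrBr.
  by apply/andP; split; lra.
have Xgap x y : x \in P -> y \in P -> (X x <= X y)%N ->
    (X y - X x)%:R <= 2 * (N%:R * `|g x - g y|).
  move=> xP yP xy; have [->|nxy] := eqVneq x y.
    by rewrite !subnn subrr normr0 !mulr0.
  have := Ngap _ _ xP yP nxy.
  have := Xg _ xP; have := Xg _ yP; rewrite -!natr1 natrB//.
  move=> /andP[a1 a2] /andP[a3 a4].
  have : N%:R * g y - N%:R * g x <= N%:R * `|g x - g y|.
    by rewrite -mulrBr ler_pM2l// distrC ler_norm.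
  move=> ? ?; lra.
have otauT x : x \in P -> d o x <= 2 / N%:R * T%:R.
  move=> /otau /le_trans; apply; rewrite mulrAC -ler_pdivrMr ?invr_gt0// invrK.
  by rewrite mulrC; apply: le_trans T1 _; rewrite ler_peMl ?ler1n.
have meetsW (C : {set V}) y : C \subset P ->
    meets C (W y) = [exists c in C, X c <= y < X c + T]%N.
  move=> CP; apply/set0Pn/exists_inP => [[c]|[c cC cy]].
    by rewrite !inE => /andP[/andP[_ cy] cC]; exists c.
  by exists c; rewrite !inE (subsetP CP)//= cC cy.
(* Points are added from left to right. A new rightmost point [c] is met by [minn T (X c - X c')]
   new windows, which pay for a link to the previous point [c'], or to the apex when the gap is at
   least [T]. *)
have b2 (C : {set V}) : C \subset P -> connects d (o |: C) (cutsum s (meets C)).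
  elim/(set_ind_max (X := X)): C => // [_|c C cmax cC IH].
    by rewrite setU0; apply: connects1 => //; rewrite sE mulr_ge0 ?(ltW k0).
  rewrite subUset sub1set => /andP[cP CP].
  have cCP : c |: C \subset P by rewrite subUset sub1set cP.
  have [C0|/(set_argmax X)[c' c'C c'max]] := eqVneq C set0.
    apply: (connects_sub _ _ (connects_pair d o c)); first by rewrite C0 setU0.
    apply: le_trans (otauT _ cP) _; rewrite sE ler_pM2l// ler_nat.
    have <- : count (fun y => X c <= y < X c + T)%N (iota 0 Y) = T.
      by rewrite count_iota_itv ?XY// addKn.
    by apply: sub_count => y cy; rewrite /= meetsW//; apply/exists_inP; exists c; rewrite ?setU11.
  have c'P := subsetP CP _ c'C.
  have cnt : (count (meets C \o W) (iota 0 Y) + minn T (X c - X c') <=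
      count (meets (c |: C) \o W) (iota 0 Y))%N.
    have <- : count (fun y => maxn (X c) (X c' + T) <= y < X c + T)%N (iota 0 Y) =
        minn T (X c - X c')%N.
      by rewrite count_iota_itv ?XY//; move: (cmax _ c'C); clear; lia.
    apply: count_disjointU => y /=.
      rewrite meetsW//; apply/negP => /andP[/exists_inP[c2 /c'max]] /=; clear; lia.
    rewrite !meetsW//; case/orP => [/exists_inP[c2 c2C c2y]|cy].
      by apply/exists_inP; exists c2; rewrite // inE c2C orbT.
    by apply/exists_inP; exists c; rewrite ?setU11//; move: cy; clear; lia.
  have step x : x \in o |: C -> d x c <= 2 / N%:R * (minn T (X c - X c'))%:R ->
      connects d (o |: (c |: C)) (cutsum s (meets (c |: C))).
    move=> xC dx; apply: (connects_sub _ _ (connects_union _ (IH CP) (connects_pair d x c))).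
    - by rewrite setUCA setUC subUset sub1set; apply/andP; split; rewrite ?subsetUl// !inE eqxx !orbT.
    - apply: le_trans (lerD (lexx _) dx) _.
      by rewrite !sE -mulrDr ler_pM2l// -natrD ler_nat.
    - by apply/set0Pn; exists x; rewrite inE xC !inE eqxx.
  have [Tle|Tgt] := leqP T (X c - X c').
    by apply: (step o); rewrite ?setU11// (minn_idPl Tle) otauT.
  apply: (step c'); first by rewrite inE c'C orbT.
  by rewrite (minn_idPr (ltnW Tgt)) gapX// cmax.
have chain (C : {set V}) c0 c1 : C \subset P -> c0 \in C -> (forall c, c \in C -> X c0 <= X c)%N ->
    c1 \in C -> (forall c, c \in C -> X c <= X c1)%N ->
    connects d C (2 / N%:R * (X c1 - X c0)%:R).
  elim/(set_ind_max (X := X)): C c1 => // [c1 _|c C cmax cC IH c1]; first by rewrite inE.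
  rewrite subUset sub1set => /andP[cP CP] c0C c0min c1C c1max.
  have c1E : X c1 = X c.
    apply/eqP; rewrite eqn_leq c1max ?setU11// andbT.
    by move: c1C; rewrite in_setU1 => /orP[/eqP ->//|/cmax].
  have [C0|/(set_argmax X)[c' c'C c'max]] := eqVneq C set0.
    by rewrite C0 setU0; apply: connects1 => //; rewrite mulr_ge0 ?(ltW k0).
  have c'P := subsetP CP _ c'C.
  have c0C' : c0 \in C.
    move: c0C; rewrite in_setU1 => /orP[/eqP c0E|//].
    have := c0min c'; rewrite in_setU1 c'C orbT c0E => /(_ isT) cc'.
    suff cE : c = c' by rewrite cE c'C in cC.
    by apply: Xinj => //; apply/eqP; rewrite eqn_leq cc' cmax.
  apply: (connects_sub _ _ (connects_union _ (IH c' CP c0C' _ c'C c'max) (connects_pair d c' c))).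
  - by rewrite setUC setUS// sub1set !inE eqxx orbT.
  - apply: le_trans (lerD (lexx _) (gapX _ _ c'P cP (cmax _ c'C))) _.
    rewrite -mulrDr ler_pM2l// -natrD ler_nat c1E.
    by move: (cmax _ c'C) (c'max _ c0C'); clear; lia.
  - by apply/set0Pn; exists c'; rewrite inE c'C !inE eqxx.
  - by move=> c2' c2C'; apply: c0min; rewrite inE c2C' orbT.
exists s; split.
- split => //.
  + by move=> c /mapP[y _ ->] /=; exact: ltW.
  + by move=> c /mapP[y _ ->] /=; apply/subsetP => x; rewrite inE => /andP[].
  + move=> C CP C0.
    have [[c1 c1C c1max] [c0 c0C c0min]] := (set_argmax X C0, set_argmin X C0).
    (* If [C] is too wide for a window, splitting and meeting are the same and [b2] applies.
       Otherwise the windows that contain [c0] but not yet [c1] pay for the chain through all of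
       [C]. *)
    have [far|near] := leqP (X c0 + T) (X c1).
      apply: (connects_sub _ _ (b2 C CP)); first exact: subsetUr.
      rewrite !sE ler_pM2l// ler_nat; apply: sub_count => y /= yC; apply/andP; split => //.
      apply/negP => /subsetP CW; have := CW _ c0C; have := CW _ c1C.
      rewrite !inE; move: far; clear; lia.
    apply: (connects_sub _ _ (chain C c0 c1 CP c0C c0min c1C c1max)) => //.
    rewrite sE ler_pM2l// ler_nat -(@count_iota_itv _ _ Y); last first.
      by apply: leq_trans (XY _ (subsetP CP _ c1C)); rewrite leq_addr.
    apply: sub_count => y /= cy; apply/andP; split.
      by apply/set0Pn; exists c0; rewrite !inE (subsetP CP)// c0C; move: cy near; clear; lia.
    apply/negP => /subsetP/(_ _ c1C); rewrite inE; move: cy; clear; lia.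
- move=> x y xP yP.
  wlog xy : x y xP yP / (X x <= X y)%N.
    move=> H; have [/H->//|/ltnW/H] := leqP (X x) (X y).
    rewrite distrC => /(_ yP xP); rewrite (@cutsum_eq _ _ _ _ (separates y x))//.
    by move=> c _; rewrite /separates eq_sym.
  rewrite sE; apply: (@le_trans _ _ (2 / N%:R * (2 * (X y - X x))%:R)).
    rewrite ler_pM2l// ler_nat.
    apply: (@leq_trans (count (fun z => X x <= z < X y)%N (iota 0 Y) +
        count (fun z => X x + T <= z < X y + T)%N (iota 0 Y))%N).
      rewrite -count_predUI; apply: leq_trans (leq_addr _ _); apply: sub_count => z /=.
      rewrite /separates !inE xP yP /=; move: xy; clear; lia.
    by rewrite !count_iota_itv ?XY//; move: (XY _ yP) xy; clear; lia.
  have := Xgap _ _ xP yP xy; rewrite natrM.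
  rewrite mulrAC -ler_pdivlMr ?invr_gt0// invrK; lra.
- move=> x xP; rewrite sE.
  apply: (@le_trans _ _ (2 / N%:R * T%:R)).
    rewrite ler_pM2l// ler_nat -[leqRHS](addKn (X x)) -(@count_iota_itv _ _ Y) ?XY//.
    by apply: sub_count => y /=; rewrite inE xP.
  by rewrite mulrAC -ler_pdivlMr ?invr_gt0// invrK; lra.
Qed.

End Line.

(** * Shortest paths in induced subgraphs *)

Section Geodesic.
Variables (R : realType) (G : graph) (d : G -> G -> R).
Hypothesis dm : is_metric d.

Lemma seq_length_shorten (x : G) p : seq_length d x (shorten x p) <= seq_length d x p.
Proof.
elim: p x => [|y p IH] x //=; rewrite fun_if seq_length_cons [leRHS]seq_length_cons.
case: ifP => _; last by rewrite lerD2l IH.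
apply: le_trans (IH x) _; case: p {IH} => [|z p].
  by rewrite !seq_length_nil addr0 metric_ge0.
by rewrite !seq_length_cons addrA lerD2r metric_triangle.
Qed.

Lemma mem_split_last (x : G) s p : x \in s :: p ->
  exists p1 p2, p = p1 ++ p2 /\ last s p1 = x.
Proof. by case/splitPl => p1 p2 <-; exists p1, p2. Qed.

(** Paths can be shortened to simple ones without gaining length, which leaves finitely many
    candidates. *)
Lemma shortest_path (e : rel G) s v : connect e s v -> exists p,
  [/\ path e s p, last s p = v &
      forall q, path e s q -> last s q = v -> seq_length d s p <= seq_length d s q].
Proof.
move=> sv; pose good (q : #|G|.-bseq G) := path e s q && (last s q == v).
have short q : path e s q -> last s q = v ->
    exists2 q' : #|G|.-bseq G, good q' & seq_length d s q' <= seq_length d s q.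
  move=> sq qv; move: (seq_length_shorten s q) qv.
  case/shortenP: sq => q' sq' uq' _ len qv.
  have sz : (size q' <= #|G|)%N.
    by apply: ltnW; rewrite -[_.+1]/(size (s :: q')) -(card_uniqP uq') max_card.
  by exists (Bseq sz) => //=; rewrite /good /= sq' qv eqxx.
have [q0 sq0 q0v] := connectP sv.
have [|q1 q1good _] := short _ sq0; first by rewrite q0v.
case: (arg_minP (fun q : #|G|.-bseq G => seq_length d s q) q1good).
move=> q /andP[sq /eqP qv] qmin; exists q; split => // q' sq' q'v.
by have [q2 /qmin/le_trans H /H] := short _ sq' q'v.
Qed.

(** Here [g] is the length of a shortest path from [s] inside [H]. It may exceed [d], hence the
    Lipschitz bound only along edges. Prefixes of a shortest path are shortest, so along the path
    differences of [g] are lengths of segments, which dominate [d]. *)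
Lemma geodesic_path (H : {set G}) s t : connected_in H -> s \in H -> t \in H ->
  exists (p : seq G) (g : G -> R),
  [/\ path [rel u v | [&& u \in H, v \in H & adj u v]] s p /\ last s p = t,
      {in H, forall x, 0 <= g x},
      {in H &, forall u v, adj u v -> `|g u - g v| <= d u v} &
      {in s :: p &, forall x y, d x y <= `|g x - g y|}].
Proof.
move=> [_ Hc] sH tH; set e := [rel u v | _].
have [f fP] : {f : G -> seq G & forall v, v \in H -> [/\ path e s (f v), last s (f v) = v &
    forall q, path e s q -> last s q = v -> seq_length d s (f v) <= seq_length d s q]}.
  apply: (@choice _ _ (fun v p => v \in H -> [/\ path e s p, last s p = v &
    forall q, path e s q -> last s q = v -> seq_length d s p <= seq_length d s q])).
  move=> v; have [vH|vH] := boolP (v \in H); last by exists [::].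
  by have [p ?] := shortest_path (Hc _ _ sH vH); exists p.
pose g v := seq_length d s (f v).
have gle u v : u \in H -> v \in H -> adj u v -> g v <= g u + d u v.
  move=> uH vH uv; have [[pu lu _] [_ _ vmin]] := (fP _ uH, fP _ vH).
  apply: (le_trans (vmin (rcons (f u) v) _ _)); rewrite ?last_rcons//.
    by rewrite rcons_path pu lu /= uH vH uv.
  by rewrite -cats1 seq_length_cat lu seq_length_cons seq_length_nil addr0.
have [pt lt tmin] := fP _ tH.
have gprefix p1 p2 : f t = p1 ++ p2 -> last s p1 \in H /\ g (last s p1) = seq_length d s p1.
  move=> ftE; have := pt; rewrite ftE cat_path => /andP[p1p p2p].
  have lH : last s p1 \in H.
    case/lastP: p1 p1p {ftE p2p} => [//|p1 z].
    by rewrite rcons_path last_rcons => /andP[_ /and3P[]].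
  split => //; have [pl ll lmin] := fP _ lH; apply/eqP; rewrite eq_le lmin//=.
  have := tmin (f (last s p1) ++ p2); rewrite cat_path last_cat pl ll p2p.
  rewrite -last_cat -ftE lt => /(_ isT erefl).
  by rewrite ftE !seq_length_cat ll lerD2r.
exists (f t), g; split => //.
- by move=> x _; exact: seq_length_ge0.
- move=> u v uH vH uv; rewrite ler_norml; apply/andP; split.
    by rewrite lerNl opprB lerBlDl gle.
  by rewrite lerBlDl (metric_sym dm) gle// adj_sym.
have forward p1 p2 p3 : f t = p1 ++ p2 ++ p3 ->
    d (last s p1) (last s (p1 ++ p2)) <= g (last s (p1 ++ p2)) - g (last s p1).
  move=> ftE; have [_ ->] := gprefix _ _ ftE.
  rewrite catA in ftE; have [_ ->] := gprefix _ _ ftE.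
  by rewrite seq_length_cat addrAC subrr add0r last_cat seq_length_ge_dist.
move=> x y /mem_split_last[p1 [p2 [ftE <-]]]; rewrite ftE -cat_cons mem_cat.
case/orP=> [/mem_split_last[q1 [q2 [p1E <-]]]|yp2].
  apply: le_trans (ler_norm _); rewrite (metric_sym dm) p1E; apply: (forward _ _ p2).
  by rewrite ftE p1E catA.
have /mem_split_last[q1 [q2 [p2E <-]]] : y \in last s p1 :: p2 by rewrite inE yp2 orbT.
by rewrite distrC -last_cat; apply: le_trans (forward _ _ q2 _) (ler_norm _); rewrite ftE p2E.
Qed.

End Geodesic.

(** * Peeling off a geodesic path *)

Section Hang.
Variables (R : realType) (V : finType) (d : V -> V -> R).
Implicit Types (C S Q : {set V}) (s : seq (R * {set V})).

Variables (H P : {set V}) (o : V) (sP : seq (R * {set V})) (phi : V -> V).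
Variables (QQ : {set {set V}}) (sQ : {set V} -> seq (R * {set V})) (q : {set V} -> V).
Hypotheses (QQpart : partition QQ (H :\: P)).
Hypotheses (phiP : {in P, phi =1 id}).
Hypotheses (phiQ : forall Q, Q \in QQ -> {in Q, forall v, phi v = q Q}).
Hypotheses (qP : forall Q, Q \in QQ -> q Q \in P).
Hypotheses (sPc : captures d P o sP) (sQc : forall Q, Q \in QQ -> captures d Q (q Q) (sQ Q)).

Let push (S : {set V}) := [set v in H | phi v \in S].

(** The map [phi] retracts [H] onto [P], collapsing each piece [Q] to its hanging point [q Q]. Cuts
    of [P] are pulled back along [phi], and the cuts of each piece are kept as they are. *)
Definition hang : seq (R * {set V}) :=
  [seq (c.1, push c.2) | c <- sP] ++
  flatten [seq sQ Q | Q <- enum QQ].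

Lemma cutsum_hang (E : pred {set V}) : cutsum hang E =
  cutsum sP (E \o push) + \sum_(Q in QQ) cutsum (sQ Q) E.
Proof.
by rewrite cutsum_cat cutsum_flatten big_enum /cutsum big_map.
Qed.

Lemma hang_part v : v \in H -> v \notin P -> exists2 Q, Q \in QQ & v \in Q.
Proof.
move=> vH vP; have : v \in cover QQ by rewrite (cover_partition QQpart) inE vP.
by case/bigcupP => Q; exists Q.
Qed.

Lemma hang_sub Q : Q \in QQ -> Q \subset H :\: P.
Proof. by move=> QQ'; rewrite -(cover_partition QQpart) bigcup_sup. Qed.

Lemma phi_in v : v \in H -> phi v \in P.
Proof.
move=> vH; have [vP|/(hang_part vH)[Q QQ' vQ]] := boolP (v \in P); first by rewrite phiP.
by rewrite (phiQ QQ' vQ) qP.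
Qed.

Let phi_sub C : C \subset H -> phi @: C \subset P.
Proof. by move=> CH; apply/subsetP => w /imsetP[v /(subsetP CH) vH ->]; exact: phi_in. Qed.

Let meets_push C S : C \subset H -> meets C (push S) = meets (phi @: C) S.
Proof.
move=> CH; apply/set0Pn/set0Pn => [[v]|[w /setIP[wS /imsetP[v vC vE]]]].
  by rewrite !inE => /andP[/andP[_ vS] vC]; exists (phi v); rewrite inE vS imset_f.
by exists v; rewrite !inE (subsetP CH)//= -vE wS.
Qed.

Let splits_push C S : C \subset H -> splits C (push S) = splits (phi @: C) S.
Proof.
move=> CH; rewrite /splits; congr (_ && ~~ _); first exact: meets_push.
apply/subsetP/subsetP => [CS w /imsetP[v /CS]|CS v vC].
  by rewrite inE => /andP[_ vS] ->.
by rewrite inE (subsetP CH)//= CS// imset_f.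
Qed.

(** Each piece met by [C] is joined to its hanging point, which lies in [phi @: C]; the cuts of the
    piece that meet [C] pay for it. *)
Let attach (A : {set V}) a C : C \subset H -> phi @: C \subset A -> connects d A a ->
  connects d (A :|: C) (a + \sum_(Q in QQ) cutsum (sQ Q) (meets C)).
Proof.
move=> CH CA Aa.
have := connects_bigU (index_enum _) (P := fun Q : {set V} => (Q \in QQ) && (C :&: Q != set0))
  (B := fun Q : {set V} => q Q |: (C :&: Q)) (b := fun Q : {set V} => cutsum (sQ Q) (meets (C :&: Q))) Aa.
have HQ (Q : {set V}) : (Q \in QQ) && (C :&: Q != set0) ->
    connects d (q Q |: (C :&: Q)) (cutsum (sQ Q) (meets (C :&: Q))) /\
    A :&: (q Q |: (C :&: Q)) != set0.
  move=> /andP[QQ' /set0Pn[v /setIP[vC vQ]]]; split.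
    by case: (sQc QQ') => _ _ _; apply; exact: subsetIr.
  apply/set0Pn; exists (q Q); rewrite !inE eqxx andbT (subsetP CA)//.
  by apply/imsetP; exists v; rewrite ?(phiQ QQ' vQ).
move=> /(_ HQ); apply: connects_sub.
  rewrite subUset subsetUl; apply/subsetP => v vC; rewrite inE.
  have [vP|vP] := boolP (v \in P).
    by rewrite (subsetP CA)//; apply/imsetP; exists v; rewrite // phiP.
  have [Q QQ' vQ] := hang_part (subsetP CH _ vC) vP.
  apply/orP; right; apply/bigcupP; exists Q; last by rewrite !inE vC vQ orbT.
  by rewrite QQ'; apply/set0Pn; exists v; rewrite inE vC.
rewrite lerD2l big_mkcond [leRHS]big_mkcond ler_sum// => Q _ /=.
case: (boolP (Q \in QQ)) => //= QQ'; have [s0 sQ' _ _] := sQc QQ'.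
case: ifP => _; last exact: cutsum_ge0.
apply: cutsum_le => // c cs /set0Pn[v]; rewrite !inE => /and3P[vc vC _].
by apply/set0Pn; exists v; rewrite inE vc.
Qed.

Lemma hang_captures : captures d H o hang.
Proof.
have [sP0 sPP sP1 sP2] := sPc.
split.
- move=> c; rewrite mem_cat => /orP[/mapP[c' /sP0 c'0 ->] //|/flatten_mapP[Q]].
  by rewrite mem_enum => /sQc[+ _ _ _]; apply.
- move=> c; rewrite mem_cat => /orP[/mapP[c' _ ->]|/flatten_mapP[Q]] /=.
    by apply/subsetP => v; rewrite inE => /andP[].
  rewrite mem_enum => QQ' cQ; have [_ /(_ _ cQ) cQ' _ _] := sQc QQ'.
  by apply: subset_trans cQ' (subset_trans (hang_sub QQ') (subsetDl _ _)).
- move=> C CH C0; rewrite cutsum_hang.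
  (* Inside a single piece its own cuts suffice. Otherwise no cut of a piece contains [C], so every
     such cut meeting [C] also splits it, and [attach] applies. *)
  have [/exists_inP[Q QQ' CQ]|/exists_inPn nQ] := boolP [exists Q in QQ, C \subset Q].
    case: (sQc QQ') => _ _ /(_ _ CQ C0) H1 _; apply: (connects_sub _ _ H1) => //.
    rewrite (bigD1 Q)//= addrCA lerDl addr_ge0 ?cutsum_ge0//.
    by apply: sumr_ge0 => Q' /andP[/sQc[? _ _ _] _]; exact: cutsum_ge0.
  have phiC0 : phi @: C != set0.
    by case/set0Pn: C0 => v vC; apply/set0Pn; exists (phi v); rewrite imset_f.
  have := attach CH (subxx _) (sP1 _ (phi_sub CH) phiC0).
  apply: connects_sub; first exact: subsetUr.
  rewrite lerD//.
    by rewrite le_eqVlt; apply/orP; left; apply/eqP/cutsum_eq => c _; rewrite -splits_push.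
  apply: ler_sum => Q QQ'; have [s0 sQ' _ _] := sQc QQ'.
  apply: cutsum_le => // c /sQ' cQ meet; rewrite /splits -[X in X && _]/(meets C c.2) meet /=.
  by apply: contra (nQ _ QQ') => /subset_trans; apply.
- move=> C CH; rewrite cutsum_hang.
  have := attach CH (subsetUr [set o] _) (sP2 _ (phi_sub CH)).
  apply: connects_sub; first by rewrite setUAC subsetUl.
  rewrite lerD2r le_eqVlt; apply/orP; left; apply/eqP/cutsum_eq => c _.
  by rewrite -meets_push.
Qed.

Lemma hang_sum_mem v : v \in H ->
  \sum_(Q in QQ) cutsum (sQ Q) (fun S : {set V} => v \in S) =
  if v \in P then 0 else cutsum (sQ (pblock QQ v)) (fun S : {set V} => v \in S).
Proof.
move=> vH; have notin Q : Q \in QQ -> v \notin Q -> cutsum (sQ Q) (fun S : {set V} => v \in S) = 0.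
  move=> QQ' vQ; have [_ sQ' _ _] := sQc QQ'.
  by apply: cutsum0 => c /sQ' /subsetP/(_ v) cQ; apply: contra vQ.
case: (boolP (v \in P)) => [vP|vP].
  apply: big1 => Q QQ'; apply: notin => //.
  by apply/negP => /(subsetP (hang_sub QQ')); rewrite inE vP.
have [Q QQ' vQ] := hang_part vH vP.
have /and3P[_ triv _] := QQpart.
rewrite (def_pblock triv QQ' vQ) (bigD1 Q)//= big1 ?addr0// => Q' /andP[QQ'' Q'Q].
apply: notin => //; apply: contraNN Q'Q => vQ'.
by rewrite -(def_pblock triv QQ' vQ) -(def_pblock triv QQ'' vQ').
Qed.

Lemma hang_mem v : v \in H -> cutsum hang (fun S : {set V} => v \in S) =
  cutsum sP (fun S : {set V} => phi v \in S) +
  if v \in P then 0 else cutsum (sQ (pblock QQ v)) (fun S : {set V} => v \in S).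
Proof.
move=> vH; rewrite cutsum_hang hang_sum_mem//; congr (_ + _).
by apply: cutsum_eq => c _; rewrite /= inE vH.
Qed.

Lemma hang_separates u v : u \in H -> v \in H ->
  cutsum hang (separates u v) <= cutsum sP (separates (phi u) (phi v)) +
   ((if u \in P then 0 else cutsum (sQ (pblock QQ u)) (fun S : {set V} => u \in S)) +
    (if v \in P then 0 else cutsum (sQ (pblock QQ v)) (fun S : {set V} => v \in S))).
Proof.
move=> uH vH; rewrite cutsum_hang -!hang_sum_mem//; apply: lerD.
  by rewrite le_eqVlt; apply/orP; left; apply/eqP/cutsum_eq => c _; rewrite /separates /= !inE uH vH.
rewrite -big_split ler_sum// => Q QQ'; have [s0 _ _ _] := sQc QQ'.
by apply: cutsum_leU => // c _; rewrite /separates; case: (u \in _); case: (v \in _).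
Qed.

Lemma hang_separates_same u v Q : Q \in QQ -> u \in Q -> v \in Q ->
  cutsum hang (separates u v) = cutsum (sQ Q) (separates u v).
Proof.
move=> QQ' uQ vQ; rewrite cutsum_hang.
have QH w : w \in Q -> w \in H.
  by move=> /(subsetP (hang_sub QQ')); rewrite inE => /andP[].
rewrite cutsum0 ?add0r; last first.
  by move=> c _; rewrite /separates /= !inE !QH// (phiQ QQ' uQ) (phiQ QQ' vQ) eqxx.
rewrite (bigD1 Q)//= big1 ?addr0// => Q' /andP[QQ'' Q'Q]; have [_ sQ' _ _] := sQc QQ''.
have /and3P[_ /trivIsetP triv _] := QQpart.
have dis := triv _ _ QQ'' QQ' Q'Q.
apply: cutsum0 => c /sQ' cQ; rewrite /separates negbK.
have notin w : w \in Q -> w \in c.2 = false.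
  by move=> wQ; apply: contraTF wQ => /(subsetP cQ) wQ'; rewrite (disjointFr dis).
by rewrite !notin.
Qed.

End Hang.

(** * Randomly shifted grids and averages of cut families *)

Lemma sum_divn_shift M x : (0 < M)%N -> (\sum_(j < M) (x + j) %/ M = x)%N.
Proof.
case: M => // M _; elim: x => [|x IH].
  by rewrite big1// => j _; rewrite add0n divn_small.
rewrite big_ord_recr /= (_ : x.+1 + M = 1 * M.+1 + x)%N; last by lia.
rewrite divnMDl// addnCA add1n; congr _.+1; rewrite -[RHS]IH big_ord_recl /= addn0 addnC.
by congr addn; apply: eq_bigr => j _; rewrite /bump /= add1n addnS.
Qed.

(** By Hermite's identity [sum_divn_shift], the cell numbers of [x] and [y] differ by [y - x] in
    total over all shifts, and each shift separating them contributes at least 1. *)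
Lemma count_divn_shift M x y : (0 < M)%N ->
  (\sum_(j < M) ((x + j) %/ M != (y + j) %/ M) <= (x - y) + (y - x))%N.
Proof.
move=> M0; wlog xy : x y / (x <= y)%N.
  move=> H; have [/H//|/ltnW/H] := leqP x y.
  by rewrite addnC; apply: leq_trans; apply: leq_sum => j _; rewrite eq_sym.
apply: leq_trans (leq_addl _ _); rewrite leq_subRL// -{1}(sum_divn_shift x M0).
rewrite -{2}(sum_divn_shift y M0) -big_split leq_sum// => j _.
have : ((x + j) %/ M <= (y + j) %/ M)%N by rewrite leq_div2r// leq_add2r.
by rewrite leq_eqVlt; case: eqVneq => /= [->|_]; rewrite ?addn0// addn1.
Qed.

Section Shift.
Variable R : realType.

Lemma truncn_dist (x y : R) : 0 <= x -> 0 <= y ->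
  ((Num.truncn x - Num.truncn y) + (Num.truncn y - Num.truncn x))%:R <= `|x - y| + 1.
Proof.
wlog xy : x y / x <= y.
  move=> H x0 y0; have [xy|/ltW yx] := leP x y; first exact: H.
  by rewrite addnC distrC; apply: H.
move=> x0 y0; have /andP[x1 x2] := truncn_itv x0; have /andP[y1 y2] := truncn_itv y0.
have tle : (Num.truncn x <= Num.truncn y)%N.
  by rewrite -ltnS -(ltr_nat R); apply: le_lt_trans y2; exact: le_trans xy.
rewrite (eqP (tle : _ - _ == 0)%N) add0n natrB// distrC ger0_norm ?subr_ge0//.
move: (Num.truncn x) (Num.truncn y) x1 x2 y1 y2 {tle} => a b.
rewrite -!natr1 => ? ? ? ?; lra.
Qed.

(* Randomly shifted grid of mesh 1, points being rounded to multiples of [1/M]. *)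
Lemma sum_shift_separates M (x y : R) : (0 < M)%N -> 0 <= x -> 0 <= y ->
  \sum_(j < M) ((Num.truncn (M%:R * x) + j) %/ M != (Num.truncn (M%:R * y) + j) %/ M)%N%:R
    <= M%:R * `|x - y| + 1 :> R.
Proof.
move=> M0 x0 y0; rewrite -natr_sum -(ger0_norm (ler0n R M)) -normrM mulrBr ger0_norm//.
apply: le_trans (truncn_dist _ _); rewrite ?mulr_ge0// ler_nat.
exact: count_divn_shift.
Qed.

Lemma shift_cell M j (x : R) : (0 < M)%N -> 0 <= x ->
  let n := ((Num.truncn (M%:R * x) + j) %/ M)%N in
  n%:R - j%:R / M%:R <= x < n%:R + 1 - j%:R / M%:R.
Proof.
move=> M0 x0; have M0' : 0 < M%:R :> R by rewrite ltr0n.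
have /andP[] := truncn_itv (mulr_ge0 (ltW M0') x0).
have := divn_eq (Num.truncn (M%:R * x) + j) M.
have := ltn_pmod (Num.truncn (M%:R * x) + j) M0.
move: (Num.truncn _) => t; move: (_ %/ M)%N (_ %% M)%N => n l lM tE /=.
have l1 : t%:R + j%:R = n%:R * M%:R + l%:R :> R by rewrite -natrD tE natrD natrM.
have l2 : l%:R + 1 <= M%:R :> R by rewrite natr1 ler_nat.
have l3 : 0 <= l%:R :> R by [].
have jM : j%:R = M%:R * (j%:R / M%:R) :> R by rewrite mulrC divfK// gt_eqF.
rewrite -natr1 => t1 t2; move: l1; rewrite {1}jM; move: (j%:R / M%:R) => b l1.
by apply/andP; split; [rewrite -(ler_pM2l M0')|rewrite -(ltr_pM2l M0')]; lra.
Qed.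

End Shift.

Section Average.
Variables (R : realType) (V : finType) (d : V -> V -> R).

(** The smallest of the costs suffices to connect [C], and the average is no smaller. *)
Lemma connects_avg (I : finType) (f : I -> R) C : (0 < #|I|)%N ->
  (forall i, connects d C (f i)) -> connects d C (#|I|%:R^-1 * \sum_i f i).
Proof.
move=> I0 H; have /card_gt0P[i0 _] := I0.
case: (arg_minP f (isT : xpredT i0)) => i _ imin.
apply: (connects_sub (subxx _) _ (H i)).
by rewrite mulrC ler_pdivlMr ?ltr0n// mulr_natr -sumr_const ler_sum//.
Qed.

Definition average (I : finType) (s : I -> seq (R * {set V})) : seq (R * {set V}) :=
  flatten [seq [seq (#|I|%:R^-1 * c.1, c.2) | c <- s i] | i <- enum I].

Lemma cutsum_average (I : finType) (s : I -> seq (R * {set V})) (E : pred {set V}) :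
  cutsum (average s) E = #|I|%:R^-1 * \sum_i cutsum (s i) E.
Proof.
rewrite cutsum_flatten mulr_sumr big_enum; apply: eq_bigr => i _.
by rewrite /cutsum big_map mulr_sumr.
Qed.

Lemma captures_average (I : finType) H o (s : I -> seq (R * {set V})) :
  (0 < #|I|)%N -> (forall i, captures d H o (s i)) -> captures d H o (average s).
Proof.
move=> I0 sc; split.
- move=> c /flatten_mapP[i _ /mapP[c' c's ->]] /=.
  by have [s0 _ _ _] := sc i; rewrite mulr_ge0 ?s0// invr_ge0.
- move=> c /flatten_mapP[i _ /mapP[c' c's ->]] /=.
  by have [_ sH _ _] := sc i; exact: sH.
- move=> C CH C0; rewrite cutsum_average; apply: connects_avg => // i.
  by have [_ _ s1 _] := sc i; exact: s1.
- move=> C CH; rewrite cutsum_average; apply: connects_avg => // i.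
  by have [_ _ _ s2] := sc i; exact: s2.
Qed.

End Average.

(** * Peeling for one fixed labeling *)

Section Peel.
Variables (R : realType) (G : graph) (d : G -> G -> R).
Hypothesis dm : is_metric d.

(* [ler_distD] for the instance of the norm that [lra] recognizes. *)
Lemma dist_triangle (y x z : R) : `|x - z| <= `|x - y| + `|y - z|.
Proof. exact: ler_distD. Qed.

(** The last bound prices the cuts at a vertex by the radius [tau] of the piece; one level up it
    pays for the edges that leave the piece. *)
Definition adapted (H : {set G}) (o : G) (tau D : R) (s : seq (R * {set G})) : Prop :=
  [/\ captures d H o s,
      {in H &, forall u v, adj u v -> cutsum s (separates u v) <= D * d u v} &
      {in H, forall v, cutsum s (fun S : {set G} => v \in S) <= D * tau}].

Variables (H P : {set G}) (g : G -> R) (o : G) (tau D : R).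
Hypotheses (PH : P \subset H) (tau0 : 0 < tau) (D1 : 1 <= D).
Hypothesis gLip : {in H &, forall u v, adj u v -> `|g u - g v| <= d u v}.
Hypothesis dP : {in P &, forall x y, d x y <= `|g x - g y|}.
Hypothesis otau : {in H, forall x, d o x <= tau}.
Hypothesis IH : forall (Q : {set G}) q (alpha : R), Q \subset H :\: P -> connected_in Q ->
  0 < alpha -> {in Q, forall v, d q v <= alpha} -> exists s, adapted Q q alpha D s.

Section Outcome.
Variables (sP : seq (R * {set G})) (r : G -> R) (pi : G -> G).
Variables (L : eqType) (lab : G -> L) (sc : L -> R) (c : R).
Hypothesis c0 : 0 <= c.
Hypothesis sPc : captures d P o sP.
Hypothesis sPsep : {in P &, forall x y, cutsum sP (separates x y) <= 8 * `|g x - g y|}.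
Hypothesis sPmem : {in P, forall x, cutsum sP (fun S : {set G} => x \in S) <= 4 * tau}.
Hypothesis piP : {in H, forall v, pi v \in P}.
Hypothesis dpi : {in H, forall v, d v (pi v) <= r v}.
Hypothesis gpi : {in H, forall v, `|g v - g (pi v)| <= r v}.
Hypothesis sc_r : forall v, v \in H :\: P -> 0 < r v /\ r v <= sc (lab v) <= c * r v.
Hypothesis sc_g : forall u v, u \in H :\: P -> v \in H :\: P -> lab u = lab v ->
  `|g u - g v| <= sc (lab u).

(** The pieces are the connected components of the label classes outside [P]. *)
Let e' : rel G :=
  [rel u v | [&& u \in H :\: P, v \in H :\: P, lab u == lab v & adj u v]].

Let e'_equiv : equivalence_rel (connect e').
Proof.
have sym : connect_sym e'.
  apply: sym_connect_sym => u v; rewrite /e' /=.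
  by rewrite andbCA (eq_sym (lab u)) adj_sym.
apply/equivalence_relP; split => [u|u v uv w]; first exact: connect0.
by rewrite (same_connect sym uv).
Qed.

Let QQ := equivalence_partition (connect e') (H :\: P).

Let QQpart : partition QQ (H :\: P).
Proof. by apply: equivalence_partitionP => u v w _ _ _; exact: e'_equiv. Qed.

Let QQ_lab u v : connect e' u v -> lab u = lab v.
Proof.
case/connectP => p; elim: p u => [|w p IHp] u /=; first by move=> _ ->.
by case/andP=> /and4P[_ _ /eqP -> _] /IHp.
Qed.

Let QQ_connected Q : Q \in QQ ->
  [/\ Q \subset H :\: P, connected_in Q & {in Q &, forall u v, lab u = lab v}].
Proof.
move=> QQ'; have QH : Q \subset H :\: P.
  by rewrite -(cover_partition QQpart) bigcup_sup.
have /and3P[_ triv n0] := QQpart.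
have conn u : u \in Q -> forall v, v \in H :\: P -> (v \in Q) = connect e' u v.
  move=> uQ v vH; rewrite -(def_pblock triv QQ' uQ).
  by rewrite (pblock_equivalence_partition _ (subsetP QH _ uQ) vH)// => x y z _ _ _; exact: e'_equiv.
split => //; last first.
  by move=> u v uQ vQ; apply: QQ_lab; rewrite -conn// (subsetP QH).
split; first by apply/set0Pn; apply: contraNneq n0 => <-.
move=> u v uQ vQ; have : connect e' u v by rewrite -conn// (subsetP QH).
case/connectP => p; elim: p u uQ => [|w p IHp] u uQ /=; first by move=> _ ->; exact: connect0.
case/andP=> uw wp vE; have wH : w \in H :\: P by case/and4P: uw.
have wQ : w \in Q by rewrite (conn u uQ w wH) connect1.
apply: connect_trans (IHp w wQ wp vE).
by apply: connect1; rewrite /= uQ wQ; case/and4P: uw.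
Qed.

(** A piece is hung at [pi v0] for an arbitrary point [v0] of it. Its points have [r] and their
    spread of [g] at most [sigma], so they lie within [4 * sigma] of that point; passing through [o]
    also gives [2 * tau]. Sets that are not pieces get a dummy value. *)
Let hanging Q : exists qs : G * seq (R * {set G}), Q \in QQ ->
  [/\ qs.1 \in P, captures d Q qs.1 qs.2,
     {in Q &, forall u v, adj u v -> cutsum qs.2 (separates u v) <= D * d u v},
     {in Q, forall v, cutsum qs.2 (fun S : {set G} => v \in S) <= 4 * D * (c * r v) /\
                      cutsum qs.2 (fun S : {set G} => v \in S) <= 2 * D * tau} &
     {in Q, forall v, `|g v - g qs.1| <= 2 * (c * r v)}].
Proof.
have [QQ'|nQ] := boolP (Q \in QQ); last by exists (o, [::]).
have [QH Qc Qlab] := QQ_connected QQ'; have [v0 v0Q] := Qc.1.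
have inH v : v \in Q -> v \in H by move=> /(subsetP QH); rewrite inE => /andP[].
pose q := pi v0; have qP : q \in P by rewrite piP// inH.
pose sigma := sc (lab v0).
have sigE v : v \in Q -> 0 < r v /\ r v <= sigma <= c * r v.
  by move=> vQ; rewrite /sigma (Qlab v0 v)//; apply: sc_r; apply: (subsetP QH).
have gq v : v \in Q -> `|g v - g q| <= 2 * sigma.
  move=> vQ; apply: le_trans (dist_triangle (g v0) _ _) _.
  have := gpi (inH _ v0Q); have [_ /andP[? _]] := sigE _ v0Q.
  have : `|g v - g v0| <= sigma.
    by rewrite distrC; apply: sc_g; rewrite ?(subsetP QH)//; exact: Qlab.
  by rewrite -/q => ? ?; lra.
have dq v : v \in Q -> d q v <= 4 * sigma.
  move=> vQ; rewrite (metric_sym dm); apply: le_trans (metric_triangle dm v (pi v) q) _.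
  have vH := inH _ vQ; have := dP (piP vH) qP; have := dpi vH.
  have := dist_triangle (g v) (g (pi v)) (g q); have := gpi vH; rewrite distrC.
  have := gq _ vQ; have [? /andP[? ?]] := sigE _ vQ.
  move=> ? ? ? ? ?; lra.
have dq2 v : v \in Q -> d q v <= 2 * tau.
  move=> vQ; apply: le_trans (metric_triangle dm q o v) _; rewrite (metric_sym dm).
  have := otau (inH _ vQ); have := otau (subsetP PH _ qP).
  move=> ? ?; lra.
have sig0 : 0 < sigma by have [? /andP[? ?]] := sigE _ v0Q; lra.
(* With the minimum of both radii, the first bounds the cost of cut edges and the second keeps the
   cuts at a vertex proportional to [tau]. *)
have [||||s [s1 s2 s3]] := @IH Q q (Num.min (4 * sigma) (2 * tau)) => //.
- by rewrite lt_min !mulr_gt0.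
- by move=> v vQ; rewrite le_min dq// dq2.
exists (q, s) => _; split => //= v vQ.
  have [_ /andP[_ sr]] := sigE _ vQ.
  have D0 : 0 <= D := le_trans ler01 D1.
  split; apply: le_trans (s3 _ vQ) _.
    apply: le_trans (ler_wpM2l D0 (_ : _ <= 4 * sigma)) _; first by rewrite ge_min lexx.
    by rewrite (mulrC 4 D) -mulrA ler_wpM2l// ler_wpM2l.
  by rewrite (mulrC 2 D) -mulrA ler_wpM2l// ge_min lexx orbT.
apply: le_trans (gq _ vQ) _; have [_ /andP[_ sr]] := sigE _ vQ; lra.
Qed.

Lemma peel_outcome : exists s,
  [/\ captures d H o s,
     {in H, forall v, cutsum s (fun S : {set G} => v \in S) <= (4 + 2 * D) * tau},
     {in H &, forall u v, adj u v -> u \notin P -> v \notin P -> lab u = lab v ->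
        cutsum s (separates u v) <= D * d u v} &
     {in H &, forall u v, adj u v ->
        cutsum s (separates u v) <= 8 * d u v + 20 * D * c * (r u + r v)}].
Proof.
have [qs qsP] := choice hanging.
pose q Q := (qs Q).1; pose sQ Q := (qs Q).2.
pose phi v := if v \in P then v else q (pblock QQ v).
have phiP : {in P, phi =1 id} by move=> v vP; rewrite /phi vP.
have /and3P[_ triv _] := QQpart.
have phiQ Q : Q \in QQ -> {in Q, forall v, phi v = q Q}.
  move=> QQ' v vQ; rewrite /phi (def_pblock triv QQ' vQ).
  have [/subsetP/(_ _ vQ)] := QQ_connected QQ'.
  by rewrite inE => /andP[/negbTE ->].
have qP Q : Q \in QQ -> q Q \in P by move/qsP => [].
have sQc Q : Q \in QQ -> captures d Q (q Q) (sQ Q) by move/qsP => [].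
have blk v : v \in H -> v \notin P -> pblock QQ v \in QQ /\ v \in pblock QQ v.
  move=> vH vP; have vc : v \in cover QQ by rewrite (cover_partition QQpart) inE vP.
  by rewrite mem_pblock vc pblock_mem.
have r0 v : v \in H -> 0 <= r v.
  by move=> vH; apply: le_trans (dpi vH); exact: metric_ge0.
have cr0 v : v \in H -> 0 <= c * r v by move=> vH; rewrite mulr_ge0// r0.
have D0 : 0 <= D := le_trans ler01 D1.
exists (hang H sP phi QQ sQ); split.
- exact: (hang_captures QQpart phiP phiQ qP sPc sQc).
- move=> v vH; rewrite (hang_mem _ _ QQpart sQc vH) mulrDl; apply: lerD.
    by apply: sPmem; apply: (phi_in QQpart phiP phiQ qP).
  case: ifPn => vP; first by rewrite mulr_ge0 ?(ltW tau0)// mulr_ge0// (le_trans ler01 D1).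
  by have [/qsP[_ _ _ /(_ v) memv _] /memv[]] := blk _ vH vP.
- move=> u v uH vH uv uP vP lE; have [Qu uQ] := blk _ uH uP.
  have vQ : v \in pblock QQ u.
    rewrite pblock_equivalence_partition ?inE ?uP ?vP//.
    by apply: connect1; rewrite /e' /= !inE uP vP uH vH lE eqxx.
  rewrite (hang_separates_same _ QQpart phiQ sQc Qu uQ vQ).
  by case: (qsP _ Qu) => _ _ sepQ _ _; exact: sepQ.
- move=> u v uH vH uv.
  apply: (le_trans (hang_separates _ _ QQpart sQc uH vH)).
  have mem w : w \in H -> (if w \in P then 0 else
      cutsum (sQ (pblock QQ w)) (fun S : {set G} => w \in S)) <= 4 * D * (c * r w).
    move=> wH; case: ifPn => wP; last by have [/qsP[_ _ _ /(_ w) H' _] /H'[]] := blk _ wH wP.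
    by rewrite mulr_ge0 ?cr0// mulr_ge0.
  have gphi w : w \in H -> `|g w - g (phi w)| <= 2 * (c * r w).
    move=> wH; have [wP|wP] := boolP (w \in P).
      by rewrite phiP// subrr normr0 mulr_ge0// cr0.
    have [wQ1 wQ2] := blk _ wH wP; rewrite (phiQ _ wQ1 _ wQ2).
    by case: (qsP _ wQ1) => _ _ _ _; apply.
  have phiH w : w \in H -> phi w \in P by apply: (phi_in QQpart phiP phiQ qP).
  have := sPsep (phiH _ uH) (phiH _ vH); have := mem _ uH; have := mem _ vH.
  have := dist_triangle (g u) (g (phi u)) (g (phi v)).
  have := dist_triangle (g v) (g u) (g (phi v)).
  rewrite (distrC (g (phi u)) (g u)); have := gLip uH vH uv.
  have := gphi _ uH; have := gphi _ vH.
  move=> ? ? ? ? ? ? ? ?.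
  (* The line cuts contribute [16 * c] and the pieces [4 * D * c] per unit of [r u + r v]; since
     [1 <= D], the sum is at most [20 * D * c]. *)
  apply: (@le_trans _ _ (8 * (2 * (c * r u) + 2 * (c * r v) + d u v) +
    (4 * D * (c * r u) + 4 * D * (c * r v)))); first by lra.
  have D1' : 0 <= D - 1 by rewrite subr_ge0.
  have := mulr_ge0 D1' (addr_ge0 (cr0 _ uH) (cr0 _ vH)); lra.
Qed.

End Outcome.
End Peel.

(** * Random scales and slices *)

Section RandomLabels.
Variables (R : realType) (V : finType) (A : {set V}) (e : rel V) (d : V -> V -> R).
Variables (r g : V -> R).
Hypothesis r0 : {in A, forall v, 0 < r v}.
Hypothesis g0 : {in A, forall v, 0 <= g v}.
Hypothesis d0 : {in A &, forall u v, e u v -> 0 < d u v}.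
Hypothesis rLip : {in A &, forall u v, e u v -> r v <= r u + d u v}.
Hypothesis gLip : {in A &, forall u v, e u v -> `|g u - g v| <= d u v}.

(* The first label is the position of [r] on a randomly shifted logarithmic
   grid, the second one that of [g] on a randomly shifted grid whose mesh [sc] is
   the scale of [r] given by the first label. *)
Lemma random_labels : exists (W : finType) (lab : W -> V -> nat * nat) (sc : W -> nat * nat -> R),
  [/\ (0 < #|W|)%N,
      forall w, {in A, forall v, r v <= sc w (lab w v) <= expR 1 * r v},
      forall w, {in A &, forall u v, lab w u = lab w v -> `|g u - g v| <= sc w (lab w u)} &
      {in A &, forall u v, e u v -> r u <= r v ->
        r u * \sum_w (lab w u != lab w v)%:R <= 4 * (#|W|%:R * d u v)}].
Proof.
(* The grid is so fine that its rounding error 1 is absorbed by [M%:R * (d u v / r u)]. *)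
have [M [M0 rM]] : exists M : nat, (0 < M)%N /\
    {in A &, forall u v, e u v -> r u <= M%:R * d u v}.
  have [|M [M0 hM]] := @exists_scale R (V * V)%type
      (fun p => [&& p.1 \in A, p.2 \in A & e p.1 p.2]) (fun p => d p.1 p.2 / r p.1).
    by move=> [u v] /and3P[/= uA vA uv]; rewrite divr_gt0 ?r0 ?d0.
  exists M; split => // u v uA vA uv.
  have := hM (u, v); rewrite /= uA vA uv => /(_ isT).
  by rewrite mulrA ler_pdivlMr ?r0// mul1r.
have [rho [rho0 rhor]] : exists rho : R, 0 < rho /\ {in A, forall v, rho <= r v}.
  have [|N [N0 hN]] := @exists_scale R V [in A] r; first exact: r0.
  exists N%:R^-1; rewrite invr_gt0 ltr0n; split => // v /hN.
  by rewrite -ler_pdivrMl ?ltr0n// mulr1.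
have M0' : 0 < M%:R :> R by rewrite ltr0n.
pose y v := ln (r v / rho).
have ry v : v \in A -> r v = rho * expR (y v).
  by move=> vA; rewrite lnK ?posrE ?divr_gt0 ?r0// mulrC divfK// gt_eqF.
have y0 v : v \in A -> 0 <= y v.
  by move=> vA; rewrite ln_ge0// ler_pdivlMr// mul1r rhor.
pose lev (j : 'I_M) v := ((Num.truncn (M%:R * y v) + j) %/ M)%N.
(* The upper end of the logarithmic cell of [r], hence between [r v] and [expR 1 * r v]. *)
pose sc (j : 'I_M) (n : nat) := rho * expR (n.+1%:R - j%:R / M%:R).
have sc0 j n : 0 < sc j n by rewrite mulr_gt0// expR_gt0.
pose slice (j k : 'I_M) v :=
  ((Num.truncn (M%:R * (g v / sc j (lev j v))) + k) %/ M)%N.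
pose lab (w : 'I_M * 'I_M) v := (lev w.1 v, slice w.1 w.2 v).
have sc_r j v : v \in A -> r v <= sc j (lev j v) <= expR 1 * r v.
  move=> vA; have /andP[] := shift_cell j M0 (y0 _ vA).
  rewrite -/(lev j v) /sc ry// mulrCA !ler_pM2l// -expRD !ler_expR -natr1.
  by move: (lev j v)%:R (j%:R / M%:R) => n b /= ? ?; apply/andP; split; lra.
have sc_g j k u v : u \in A -> v \in A -> lab (j, k) u = lab (j, k) v ->
    `|g u - g v| <= sc j (lev j u).
  move=> uA vA /eqP; rewrite xpair_eqE => /andP[/eqP nE /eqP].
  rewrite /slice -nE; set S := sc _ _ => mE.
  have S0 : 0 < S by exact: sc0.
  have inH w : w \in A -> 0 <= g w / S.
    by move=> wA; rewrite divr_ge0 ?g0// ltW.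
  have gE w : g w = S * (g w / S) by rewrite mulrC divfK// gt_eqF.
  rewrite (gE u) (gE v) -mulrBr normrM gtr0_norm// ler_piMr ?(ltW S0)//.
  have /andP[a1 a2] := shift_cell k M0 (inH _ uA).
  have /andP[b1 b2] := shift_cell k M0 (inH _ vA).
  rewrite mE in a1 a2; rewrite ler_norml; apply/andP; split; lra.
exists ('I_M * 'I_M)%type, lab, (fun w l => sc w.1 l.1); split.
- by rewrite card_prod card_ord muln_gt0 M0.
- by move=> w v; exact: sc_r.
- by move=> [j k] u v; exact: sc_g.
move=> u v uA vA uv ruv.
pose cut w : R := (lab w u != lab w v)%:R.
have -> : \sum_w cut w = \sum_j \sum_k cut (j, k).
  by rewrite pair_bigA; apply: eq_bigr => -[].
have levle : \sum_j (lev j u != lev j v)%:R <= M%:R * (d u v / r u) + 1 :> R.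
  apply: (le_trans (sum_shift_separates M0 (y0 _ uA) (y0 _ vA))); rewrite lerD2r ler_pM2l//.
  have yuv : y u <= y v.
    by rewrite -ler_expR -(ler_pM2l rho0) -!ry.
  rewrite distrC ger0_norm ?subr_ge0//.
  have rv : r v <= r u + d u v by apply: rLip.
  (* The logarithm of [r v / r u] is at most [r v / r u - 1], which is at most [d u v / r u]. *)
  apply: (@le_trans _ _ ((r v - r u) / r u)).
    rewrite -ler_expR expRB; apply: le_trans (expR_ge1Dx _).
    have -> : expR (y v) / expR (y u) = r v / r u.
      by rewrite (ry v vA) (ry u uA) -mulf_div divff ?mul1r// gt_eqF.
    by rewrite mulrBl divff ?gt_eqF ?r0// addrC subrK.
  by rewrite ler_pM2r ?invr_gt0 ?r0// lerBlDl.
have slicele j : lev j u = lev j v ->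
    \sum_k (slice j k u != slice j k v)%:R <= M%:R * (d u v / r u) + 1 :> R.
  move=> lE; rewrite /slice -lE; set S := sc _ _.
  have S0 : 0 < S by exact: sc0.
  apply: (le_trans (sum_shift_separates M0 _ _)); rewrite ?divr_ge0 ?g0 ?(ltW S0)//.
  rewrite lerD2r ler_pM2l// -mulrBl normrM [X in _ * X]gtr0_norm ?invr_gt0//.
  have /andP[rS _] := sc_r j u uA.
  apply: ler_pM; rewrite ?normr_ge0 ?invr_ge0 ?(ltW S0)//.
    exact: gLip.
  by rewrite lef_pV2 ?posrE ?r0.
have inner j : \sum_k cut (j, k) <=
    M%:R * (lev j u != lev j v)%:R + (M%:R * (d u v / r u) + 1).
  have dr0 : 0 <= M%:R * (d u v / r u) :> R.
    by rewrite mulr_ge0 ?divr_ge0 ?ltW ?d0 ?r0 ?ltr0n.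
  have [lE|lE] := eqVneq (lev j u) (lev j v).
    rewrite mulr0 add0r; apply: le_trans (slicele j lE); apply: ler_sum => k _.
    by rewrite /cut /lab xpair_eqE lE eqxx.
  rewrite mulr1; apply: (@le_trans _ _ (M%:R)); last by rewrite lerDl addr_ge0.
  rewrite -[M in M%:R]card_ord -sumr_const ler_sum// => k _.
  by rewrite /cut; case: (_ != _).
have Mr := rM _ _ uA vA uv.
have rd : r u * (M%:R * (d u v / r u) + 1) <= 2 * (M%:R * d u v).
  rewrite mulrDr mulr1 mulrCA (mulrC (r u)) divfK ?gt_eqF ?r0//; lra.
(* One summand accounts for different scales, the other for different slices at a common scale. *)
have total : \sum_j \sum_k cut (j, k) <=
    M%:R * (M%:R * (d u v / r u) + 1) + M%:R * (M%:R * (d u v / r u) + 1).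
  apply: le_trans (ler_sum _ (fun j _ => inner j)) _.
  rewrite big_split /= -mulr_sumr lerD//; first by rewrite ler_pM2l.
  by rewrite sumr_const card_ord -[leLHS]mulr_natl lexx.
apply: le_trans (ler_wpM2l (ltW (r0 uA)) total) _.
rewrite card_prod card_ord natrM mulrDr !(mulrCA (r u)).
have := ler_wpM2l (ltW M0') rd; lra.
Qed.

End RandomLabels.

Section Peeling.
Variables (R : realType) (G : graph) (d : G -> G -> R).
Hypothesis dm : is_metric d.

Lemma peel (H P : {set G}) (g : G -> R) o (tau D : R) :
    P \subset H -> P != set0 -> 0 < tau -> 1 <= D ->
    {in H, forall x, 0 <= g x} ->
    {in H &, forall u v, adj u v -> `|g u - g v| <= d u v} ->
    {in P &, forall x y, d x y <= `|g x - g y|} ->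
    {in H, forall x, d o x <= tau} ->
    (forall (Q : {set G}) q (alpha : R), Q \subset H :\: P -> connected_in Q ->
      0 < alpha -> {in Q, forall v, d q v <= alpha} ->
      exists s, adapted d Q q alpha D s) ->
  exists s, adapted d H o tau ((9 + 180 * expR 1) * D) s.
Proof.
move=> PH P0 tau0 D1 g0 gLip dP otau IH.
have [sP [sPc sPsep sPmem]] : exists s : seq (R * {set G}),
    [/\ captures d P o s,
        {in P &, forall x y, cutsum s (separates x y) <= 8 * `|g x - g y|} &
        {in P, forall x, cutsum s (fun S : {set G} => x \in S) <= 4 * tau}].
  by apply: line_cuts => // x /(subsetP PH); [exact: g0|exact: otau].
have /set0Pn[x0 x0P] := P0.
(* The distance [r] to [P] induced by [F] controls both the distance of [v] to
   [pi v] and the position of [pi v] on [P]. *)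
pose F v x := Num.max (d v x) `|g v - g x|.
pose pi v := [arg min_(x < x0 in P) F v x]%O.
have piP v : pi v \in P by rewrite /pi; case: arg_minP.
pose r v := F v (pi v).
have rmin v x : x \in P -> r v <= F v x.
  by rewrite /r /pi; case: arg_minP => // y _; exact.
have dpi v : d v (pi v) <= r v by rewrite le_max lexx.
have gpi v : `|g v - g (pi v)| <= r v by rewrite le_max lexx orbT.
have rLip u v : u \in H -> v \in H -> adj u v -> r v <= r u + d u v.
  move=> uH vH uv; apply: le_trans (rmin _ _ (piP u)) _; rewrite ge_max; apply/andP; split.
    apply: le_trans (metric_triangle dm v u (pi u)) _; rewrite (metric_sym dm) addrC.
    by rewrite lerD2r dpi.
  apply: le_trans (dist_triangle (g u) _ _) _; rewrite addrC lerD// distrC.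
  exact: gLip.
have rP v : v \in P -> r v = 0.
  move=> vP; apply/eqP; rewrite eq_le (le_trans (metric_ge0 dm _ _) (dpi v)) andbT.
  by apply: le_trans (rmin v v vP) _; rewrite /F metric_refl// subrr normr0 maxxx.
have rge0 v : 0 <= r v := le_trans (metric_ge0 dm _ _) (dpi v).
have r0 v : v \in H :\: P -> 0 < r v.
  rewrite inE => /andP[vP _]; apply: lt_le_trans (dpi v).
  by apply: metric_gt0 => //; apply: contraNneq vP => ->; exact: piP.
have [|||||W [lab [sc [W0 sc_r sc_g cutE]]]] :=
  @random_labels R G (H :\: P) (@adj G) d r g.
- by move=> v; exact: r0.
- by move=> v; rewrite inE => /andP[_]; exact: g0.
- move=> u v _ _ uv; apply: metric_gt0 => //.
  by apply: contraTneq uv => ->; rewrite adj_irr.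
- by move=> u v; rewrite !inE => /andP[_ uH] /andP[_ vH]; exact: rLip.
- by move=> u v; rewrite !inE => /andP[_ uH] /andP[_ vH]; exact: gLip.
have outcome w : exists s,
  [/\ captures d H o s,
     {in H, forall v, cutsum s (fun S : {set G} => v \in S) <= (4 + 2 * D) * tau},
     {in H &, forall u v, adj u v -> u \notin P -> v \notin P -> lab w u = lab w v ->
        cutsum s (separates u v) <= D * d u v} &
     {in H &, forall u v, adj u v ->
        cutsum s (separates u v) <= 8 * d u v + 20 * D * expR 1 * (r u + r v)}].
  apply: (@peel_outcome _ _ _ dm H P g o tau D PH tau0 D1 gLip dP otau IH sP r pi
    _ (lab w) (sc w) (expR 1)) => //.
  - by move=> v vH; split; [exact: r0|exact: sc_r].
  - by move=> u v uH vH; exact: sc_g.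
have [s sP'] := choice outcome.
pose cut w u v : R := (lab w u != lab w v)%:R.
exists (average s); split.
- by apply: captures_average => // w; case: (sP' w).
- move=> u v uH vH uv; rewrite cutsum_average ler_pdivrMl ?ltr0n//.
  wlog ruv : u v uH vH uv / r u <= r v.
    move=> H1; have [/H1->//|/ltW/H1] := leP (r u) (r v).
    rewrite adj_sym (metric_sym dm) => /(_ vH uH uv); apply: le_trans.
    by apply: ler_sum => w _; rewrite le_eqVlt (cutsum_eq (E2 := separates v u)) ?eqxx// => c _; rewrite /separates eq_sym.
  pose c := expR (1 : R); have c0 : 0 <= c by exact: expR_ge0.
  have D0 : 0 <= D := le_trans ler01 D1.
  have Dc0 : 0 <= D * c by rewrite mulr_ge0.
  have d0 := metric_ge0 dm u v; have rv := rLip _ _ uH vH uv.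
  pose K := (D + 8 + 20 * (D * c)) * d u v.
  (* An edge touching [P] always counts as cut. This costs nothing: its end [u] with the smaller [r]
     then has [r u = 0]. *)
  pose edge := [&& u \in H :\: P, v \in H :\: P & adj u v].
  pose B w : R := if edge then cut w u v else 1.
  (* Since [r v <= r u + d u v], the bound for a cut edge becomes a multiple of [d u v] plus
     [40 * (D * c) * r u]. As [u] and [v] get different labels with probability at most
     [4 * d u v / r u], the average is at most [D + 8 + 180 * (D * c)] times [d u v]. *)
  have each w : cutsum (s w) (separates u v) <= K + 40 * (D * c) * (r u * B w).
    have [_ _ good bad] := sP' w.
    have rB : 0 <= r u * B w.
      by rewrite mulr_ge0 ?rge0// /B; case: ifP => _ //; rewrite /cut.
    have [uvP|] := boolP [&& edge & lab w u == lab w v].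
      have /andP[/and3P[uHP vHP _] /eqP lE] := uvP.
      move: uHP vHP; rewrite !inE => /andP[uP _] /andP[vP _].
      apply: (le_trans (good _ _ uH vH uv uP vP lE)).
      apply: (@le_trans _ _ K); last by rewrite lerDl mulr_ge0// mulr_ge0.
      by rewrite ler_wpM2r// -addrA lerDl addr_ge0 ?mulr_ge0.
    move=> nE; have -> : B w = 1.
      by move: nE; rewrite /B; case: ifP => //= _; rewrite /cut => ->.
    apply: (le_trans (bad _ _ uH vH uv)); rewrite mulr1 -/c.
    have := mulr_ge0 Dc0 (_ : 0 <= r u + d u v - r v); rewrite subr_ge0 => /(_ rv).
    have := mulr_ge0 D0 d0; rewrite /K; move=> ? ?; lra.
  apply: le_trans (ler_sum _ (fun w _ => each w)) _.
  rewrite big_split /= sumr_const -!mulr_sumr -[K *+ _]mulr_natl.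
  have : r u * \sum_w B w <= 4 * (#|W|%:R * d u v).
    rewrite /B; have [uvP|nuv] := boolP (edge); first by have /and3P[u' v' _] := uvP; exact: cutE.
    suff -> : r u = 0 by rewrite mul0r !mulr_ge0.
    have [uP|uP] := boolP (u \in P); first exact: rP.
    have vP : v \in P.
      by apply: contraNT nuv => vP; rewrite /edge !inE uP vP uH vH.
    by apply/eqP; rewrite eq_le rge0 andbT -(rP _ vP).
  move/(ler_wpM2l Dc0) => /= H1.
  have N0 : 0 <= #|W|%:R * d u v by rewrite mulr_ge0.
  have : 0 <= (D - 1) * (#|W|%:R * d u v) by rewrite mulr_ge0 ?subr_ge0.
  rewrite /K -/c; move: (#|_|%:R : R) H1 N0 => N H1 N0 H2; lra.
- move=> v vH; rewrite cutsum_average ler_pdivrMl ?ltr0n//.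
  rewrite [leRHS]mulr_natl -sumr_const ler_sum// => w _.
  have [_ /(_ v vH) /le_trans H1 _ _] := sP' w; apply: H1; rewrite ler_pM2r//.
  have := expR_gt0 (1 : R); have : 0 <= D * expR 1 by rewrite mulr_ge0 ?expR_ge0// (le_trans ler01 D1).
  move=> ? ?; lra.
Qed.

End Peeling.

(** * Recursion on the width *)

Section Width.
Variables (R : realType) (G : graph) (d : G -> G -> R).
Hypothesis dm : is_metric d.

(** The two trivial splittings are exempt, so that [narrow 0] still holds for single vertices and
    [k] can drop by one at every peeling. *)
Definition narrow k (H : {set G}) : Prop := exists s : seq G,
  [/\ uniq s, s =i H & forall a b, s = a ++ b -> a <> [::] -> b <> [::] ->
     (#|bd (@adj G) H [set x in a]| < k)%N].

(** The path runs from the first to the last vertex of the enumeration, so it leaves each prefix at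
    a boundary vertex. This vertex is on [P], hence missing from the boundary within a piece [Q]. *)
Lemma narrow_geodesic k (H : {set G}) : connected_in H -> narrow k H ->
  exists (P : {set G}) (g : G -> R),
  [/\ P \subset H /\ P != set0, {in H, forall x, 0 <= g x},
      {in H &, forall u v, adj u v -> `|g u - g v| <= d u v},
      {in P &, forall x y, d x y <= `|g x - g y|} &
      forall Q : {set G}, Q \subset H :\: P -> connected_in Q ->
        exists2 k', k = k'.+1 & narrow k' Q].
Proof.
move=> Hc [[|s sigma] [us sH sk]]; first by case: Hc => -[x]; rewrite -sH.
have sinH : s \in H by rewrite -sH mem_head.
have tinH : last s sigma \in H by rewrite -sH mem_last.
have [p [g [[pp pt] g0 gLip gd]]] := geodesic_path dm Hc sinH tinH.
pose P := [set x in s :: p]; exists P, g; split => //.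
- split; last by apply/set0Pn; exists s; rewrite inE mem_head.
  apply/subsetP => x; rewrite inE => xp; case/splitPl: xp pp => p1 p2 <-.
  rewrite cat_path => /andP[+ _]; case/lastP: p1 => [//|p1 z].
  by rewrite rcons_path last_rcons => /andP[_ /and3P[]].
- by move=> x y; rewrite !inE; exact: gd.
move=> Q QH [[x0 x0Q] _].
(* A vertex off the path gives the enumeration a nontrivial prefix, whose boundary has fewer than
   [k] elements. *)
have [k' kE] : exists k', k = k'.+1.
  have : x0 \in H :\: P := subsetP QH _ x0Q.
  rewrite in_setD inE -sH in_cons negb_or => /andP[/andP[x0s _]].
  rewrite in_cons (negbTE x0s) /=; case: k sk => [|k' _ _]; last by exists k'.
  case: sigma {us sH tinH pt} => // y sigma /(_ [:: s] (y :: sigma) erefl).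
  by rewrite ltn0 => H0; case: H0.
exists k' => //.
have QsubH : Q \subset H by apply: subset_trans QH (subsetDl _ _).
exists (filter (mem Q) (s :: sigma)); split.
- exact: filter_uniq.
- by move=> x; rewrite mem_filter /= sH andb_idr//; exact: (subsetP QsubH).
move=> a' b' /filter_eq_cat[a [b [sE aE bE]]] a'0 b'0.
have a0 : a <> [::] by move=> a0; rewrite a0 in aE; exact: a'0.
have b0 : b <> [::] by move=> b0; rewrite b0 in bE; exact: b'0.
have := sk _ _ sE a0 b0; rewrite kE ltnS; apply: leq_trans.
have sa : s \in a by case: a a0 sE {aE sk} => // x a _ [-> _]; rewrite mem_head.
have ta : last s sigma \notin a.
  have : last s sigma \in b.
    case/lastP: b b0 sE {bE sk} => // b x _ /(congr1 (last s)) /=.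
    by rewrite last_cat last_rcons => ->; rewrite mem_rcons mem_head.
  by move: us; rewrite sE cat_uniq => /and3P[_ /hasPn ab _] /ab.
rewrite -pt in ta; have [x [y [xp _ xa ya /and3P[xH yH xy]]]] := path_cross (S := mem a) pp sa ta.
apply: proper_card; apply/properP; split.
  apply/subsetP => z /bdP[]; rewrite inE -aE mem_filter => /andP[/= zQ za] [w [wQ wa zw]].
  apply/bdP; split; first by rewrite inE.
  exists w; split => //; first exact: (subsetP QsubH).
  by move: wa; rewrite !inE mem_filter /= wQ.
exists x; first by apply/bdP; split; [rewrite inE|exists y; rewrite inE].
apply/negP => /bdP[]; rewrite inE -aE mem_filter => /andP[/= /(subsetP QH)].
by rewrite inE inE xp.
Qed.

(** Each peeling multiplies the constant by a fixed factor. At [k = 0] no connected piece is left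
    outside the path, and [peel] starts from the constant 1. *)
Lemma narrow_adapted k (H : {set G}) o tau : connected_in H -> narrow k H ->
  0 < tau -> {in H, forall v, d o v <= tau} ->
  exists s, adapted d H o tau ((9 + 180 * expR 1) ^+ k.+1) s.
Proof.
have K1 : 1 <= 9 + 180 * expR 1 :> R by have := expR_gt0 (1 : R); lra.
elim: k H o tau => [|k IH] H o tau Hc Hk tau0 otau.
  have [P [g [[PH P0] g0 gLip dP HQ]]] := narrow_geodesic Hc Hk.
  rewrite exprS expr0; apply: (peel dm PH P0 tau0 (lexx _) g0 gLip dP otau).
  by move=> Q q alpha QH Qc; case: (HQ Q QH Qc).
have [P [g [[PH P0] g0 gLip dP HQ]]] := narrow_geodesic Hc Hk.
rewrite exprS; apply: (peel dm PH P0 tau0 _ g0 gLip dP otau); first exact: exprn_ege1.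
move=> Q q alpha QH Qc alpha0 Qalpha.
by have [k' [<-] Qk] := HQ Q QH Qc; exact: IH.
Qed.

Lemma swept_narrow n : swept (@adj G) n [set: G] -> narrow n [set: G].
Proof. by move=> [s [us sV sn]]; exists s; split => // a b sE _ _; exact: sn sE. Qed.

End Width.

(** * The embedding into L_1 *)

Section StepFunctions.
Variables (R : realType) (n : nat).
Hypothesis n0 : (0 < n)%N.

Let mu := (@lebesgue01 R).

Definition cell (i : 'I_n) : set R := [set` `[i%:R / n%:R, i.+1%:R / n%:R[ ].

(** The heights carry a factor [n] against cells of measure [1 / n], so that the L_1 norm is the l_1
    norm of [c]. *)
Definition step_fun (c : 'I_n -> R) (x : R) : R :=
  \sum_(i < n) (n%:R * c i) * \1_(cell i) x.

Let n0' : 0 < n%:R :> R.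
Proof. by rewrite ltr0n. Qed.

Lemma measurable_cell i : measurable (cell i).
Proof. exact: measurable_itv. Qed.

Lemma cell_measure i : mu (cell i) = (n%:R^-1)%:E.
Proof.
rewrite /mu /lebesgue01 /= /mrestr (_ : _ `&` _ = cell i)%classic.
  rewrite /cell lebesgue_measure_itv /= lte_fin ltr_pM2r ?invr_gt0// ltr_nat leqnn.
  by rewrite -EFinB -mulrBl -natrB// subSnn mul1r.
apply/seteqP; split => x; first by case.
rewrite /cell => xi; split => //; move: xi; rewrite /mkset !in_itv => /andP[x1 x2].
apply/andP; split; first by apply: le_trans x1; rewrite divr_ge0.
by apply: le_trans (ltW x2) _; rewrite ler_pdivrMr// mul1r ler_nat.
Qed.

Lemma cell_disjoint i j x : cell i x -> cell j x -> i = j.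
Proof.
rewrite /cell /= !in_itv /= !ler_pdivrMr// !ltr_pdivlMr// => /andP[i1 i2] /andP[j1 j2].
have lt1 : (i < j.+1)%N by rewrite -(ltr_nat R) (le_lt_trans i1).
have lt2 : (j < i.+1)%N by rewrite -(ltr_nat R) (le_lt_trans j1).
by apply/val_inj/eqP; rewrite /= eqn_leq -ltnS lt1 -ltnS.
Qed.

Lemma measurable_step_fun c : measurable_fun [set: R] (step_fun c).
Proof.
apply: measurable_sum => i; apply: measurable_funM; first exact: measurable_cst.
by apply: measurable_indic; exact: measurable_cell.
Qed.

Lemma norm_step_fun c x : `|step_fun c x| = step_fun (fun i => `|c i|) x.
Proof.
rewrite /step_fun; have [[i xi]|no] := pselect (exists i, cell i x); last first.
  by rewrite !big1 ?normr0// => i _; rewrite indicE memNset ?mulr0// => xi; apply: no; exists i.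
have zero (a : 'I_n -> R) : \sum_(j < n | j != i) (n%:R * a j) * \1_(cell j) x = 0.
  apply: big1 => j ji; rewrite indicE memNset ?mulr0// => /(cell_disjoint xi) ij.
  by rewrite ij eqxx in ji.
rewrite (bigD1 i)//= [in RHS](bigD1 i)//= !zero !addr0 !normrM.
by rewrite (ger0_norm (ler0n _ n)) [X in _ * X]ger0_norm// indicE.
Qed.

Lemma Lnorm_step_fun c :
  ('N[mu]_1[EFin \o step_fun c] = (\sum_(i < n) `|c i|)%:E)%E.
Proof.
rewrite Lnorm1.
under eq_integral => x _ do rewrite /= norm_step_fun /step_fun -sumEFin.
rewrite ge0_integral_sum//=; last first.
  move=> i; apply/measurable_EFinP; apply: measurable_funM; first exact: measurable_cst.
  by apply: measurable_indic; exact: measurable_cell.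
rewrite -sumEFin; apply: eq_bigr => i _.
under eq_integral do rewrite EFinM.
rewrite ge0_integralZl_EFin//; last first.
  by apply/measurable_EFinP; apply: measurable_indic; exact: measurable_cell.
rewrite integral_indic //; last exact: measurable_cell.
rewrite classical_sets.setIT [X in (_ * X)%E]cell_measure -EFinM.
by rewrite mulrAC divff ?mul1r// gt_eqF.
Qed.

Lemma step_fun_Lfun c : step_fun c \in Lfun mu 1%E.
Proof.
apply/andP; split; apply/mem_set; first exact: measurable_step_fun.
by rewrite /finite_norm /= Lnorm_step_fun ltry.
Qed.

End StepFunctions.

Lemma finite_l1_embeds_L1 (R : realType) (M : Type) (dM : M -> M -> R) (I : finType)
    (h : M -> I -> R) (s D : R) : 0 < s ->
    (forall x y, s * dM x y <= \sum_i `|h x i - h y i| <= D * s * dM x y) ->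
  embeds_L1 dM D.
Proof.
(* An additional zero coordinate keeps [n] positive when [I] is empty. *)
move=> s0 hD; pose n := #|I|.+1.
pose c x (i : 'I_n) : R := if unlift ord_max i is Some j then h x (enum_val j) else 0.
have n0 : (0 < n)%N by [].
exists s, (fun x => Lfun_Sub (lexx (1%E : \bar R)) (step_fun_Lfun n0 (c x))); split => // x y.
rewrite /L1_norm (_ : EFin \o _ = EFin \o step_fun (fun i => c x i - c y i)); last first.
  apply/funext => z; congr (_%:E).
  rewrite -[LHS]/(step_fun (c x) z - step_fun (c y) z) /step_fun -sumrB; apply: eq_bigr => i _.
  by rewrite mulrBr mulrBl.
rewrite Lnorm_step_fun// !lee_fin (_ : \sum_(i < n) _ = \sum_i `|h x i - h y i|)//.
rewrite big_ord_recr /= [X in _ + X](_ : _ = 0) ?addr0; last first.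
  by rewrite /c unlift_none subrr normr0.
rewrite (reindex (@enum_val I I)) /=; last exact/onW_bij/enum_val_bij.
apply: eq_bigr => i _; rewrite /c (_ : widen_ord _ i = lift ord_max i) ?liftK//.
by apply/val_inj/esym; exact: lift_max.
Qed.

(** * From cuts of the graph to the lamplighter space *)

Section Lamplighter.
Variables (R : realType) (V : finType) (d : V -> V -> R) (D : R).
Hypothesis dm : is_metric d.
Variable s : seq (R * {set V}).
Hypothesis s0 : nonneg s.
Hypothesis s_split : forall C : {set V}, C != set0 -> connects d C (cutsum s (splits C)).

(** A cut splitting the vertex set of a walk separates two consecutive vertices of it. *)
Lemma cutsum_splits_walk x t :
  cutsum s (splits [set z in x :: t]) <= seq_length (fun u v => cutsum s (separates u v)) x t.
Proof.
elim: t x => [|y t IH] x.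
  rewrite /seq_length big_nil cutsum0// => c _; apply/negP => /andP[/set0Pn[z]].
  rewrite !inE => /andP[zc /eqP zx] /subsetPn[w]; rewrite !inE => /eqP -> /negP.
  by rewrite -zx zc.
rewrite seq_length_cons; apply: le_trans (lerD (lexx _) (IH y)).
apply: cutsum_leU => // c _ /andP[/set0Pn[z]]; rewrite in_setI => /andP[zc].
rewrite inE => zxy /subsetPn[w]; rewrite inE => wxy wc.
have yt : y \in [set z in y :: t] by rewrite inE mem_head.
rewrite /separates; have [xc|xc] := boolP (x \in c.2); have [yc|yc] //= := boolP (y \in c.2).
  apply/andP; split; first by apply/set0Pn; exists y; rewrite inE yc.
  apply/subsetPn; exists w => //; rewrite inE.
  by move: wxy; rewrite in_cons => /orP[/eqP wx|//]; rewrite wx xc in wc.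
apply/andP; split; last by apply/subsetPn; exists y.
apply/set0Pn; exists z; rewrite in_setI zc inE.
by move: zxy; rewrite in_cons => /orP[/eqP zx|//]; rewrite zx (negbTE xc) in zc.
Qed.

Hypothesis s_dist : forall u v, cutsum s (separates u v) <= D * d u v.

Lemma seq_length_le x t :
  seq_length (fun u v => cutsum s (separates u v)) x t <= D * seq_length d x t.
Proof.
elim: t x => [|y t IH] x; first by rewrite /seq_length !big_nil mulr0.
by rewrite !seq_length_cons mulrDr lerD.
Qed.

Lemma cutsum_splits_tsp x (C : {set V}) y :
  cutsum s (splits (x |: (y |: C))) <= D * tsp d x C y.
Proof.
have [[t [tl Ct ->]] _] := tsp_minimum dm x C y.
apply: le_trans (seq_length_le x t); apply: le_trans (cutsum_splits_walk x t).
apply: cutsum_le => // c _ /andP[/set0Pn[z]]; rewrite in_setI => /andP[zc zC] /subsetPn[w wC wc].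
have sub v : v \in x |: (y |: C) -> v \in [set z in x :: t].
  rewrite !in_setU1 inE => /or3P[/eqP ->|/eqP ->|/Ct//]; first exact: mem_head.
  by rewrite -tl mem_last.
apply/andP; split; first by apply/set0Pn; exists z; rewrite in_setI zc sub.
by apply/subsetPn; exists w => //; exact: sub.
Qed.

Lemma tsp_cutsum_splits x (C : {set V}) y :
  tsp d x C y <= 4 * cutsum s (splits (x |: (y |: C))).
Proof.
apply: (@le_trans _ _ (tsp d x (x |: (y |: C)) y)).
  have [_ tmin] := tsp_minimum dm x C y; apply: tmin.
  have [[t [tl Ct ->]] _] := tsp_minimum dm x (x |: (y |: C)) y.
  by exists t; split => // v vC; apply: Ct; rewrite !in_setU1 vC !orbT.
apply: (connects_tsp dm); rewrite ?in_setU1 ?eqxx ?orbT//.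
by apply: s_split; apply/set0Pn; exists x; rewrite setU11.
Qed.

Definition cut_view (S : {set V}) (p : lamplighter V) : bool * {set V} :=
  (p.2 \in S, if p.2 \in S then p.1 :\: S else p.1 :&: S).

(** Lamplighters on different sides give different views, and [S] splits their positions. On a
    common side, the views differ exactly when some lamp on the other side has changed. *)
Lemma cut_view_neq (S : {set V}) (p q : lamplighter V) :
  (cut_view S p != cut_view S q) = splits (p.2 |: (q.2 |: symdiff p.1 q.1)) S.
Proof.
case: p q => A x [B y] /=; rewrite /cut_view /splits xpair_eqE negb_and /=.
have meet v : v \in S -> v \in x |: (y |: symdiff A B) -> S :&: (x |: (y |: symdiff A B)) != set0.
  by move=> vS vC; apply/set0Pn; exists v; rewrite in_setI vS.
have noin v : v \notin S -> v \in x |: (y |: symdiff A B) -> ~~ (x |: (y |: symdiff A B) \subset S).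
  by move=> vS vC; apply/subsetPn; exists v.
have xC : x \in x |: (y |: symdiff A B) by rewrite setU11.
have yC : y \in x |: (y |: symdiff A B) by rewrite !in_setU1 eqxx orbT.
have [xS|xS] := boolP (x \in S); have [yS|yS] := boolP (y \in S) => /=.
- rewrite (meet x)//= 2!subUset !sub1set xS yS /=; congr (~~ _).
  apply/eqP/subsetP => [E v|E].
    have /setP/(_ v) := E; rewrite !inE.
    by case: (v \in S); case: (v \in A); case: (v \in B).
  apply/setP => v; have := E v; rewrite !inE.
  by case: (v \in S) => //=; case: (v \in A); case: (v \in B) => //= ->.
- by rewrite (meet x)// (noin y).
- by rewrite (meet y)// (noin x).
- rewrite (noin x)// andbT; congr (~~ _); apply/eqP/eqP => [E|E]; apply/setP => v.
    have /setP/(_ v) := E; rewrite !inE.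
    have [->|_] := eqVneq v x; first by rewrite (negbTE xS).
    have [->|_] := eqVneq v y; first by rewrite (negbTE yS).
    by case: (v \in S); case: (v \in A); case: (v \in B).
  have /setP/(_ v) := E; rewrite !inE.
  by case: (v \in S); case: (v \in A); case: (v \in B); rewrite //= !orbT.
Qed.

Lemma lamplighter_embeds_L1 : 1 <= D -> embeds_L1 (lamplighter_dist d) (4 * D).
Proof.
move=> D1; pose I := ('I_(size s) * (bool * {set V}) + V)%type.
pose c (i : 'I_(size s)) := nth (0, set0) s i.
(* One coordinate for each cut and each possible view: two different views disagree in exactly two
   of these, hence the weight [(c i).1 / 2]. The coordinates [inr v] count the changed lamps. *)
pose h (p : lamplighter V) (i : I) : R := match i with
  | inl (i, f) => (c i).1 / 2 * (cut_view (c i).2 p == f)%:R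
  | inr v => (v \in p.1)%:R
  end.
have hE p q : \sum_i `|h p i - h q i| =
    cutsum s (splits (p.2 |: (q.2 |: symdiff p.1 q.1))) + #|symdiff p.1 q.1|%:R.
  rewrite big_sumType /=; congr (_ + _).
    transitivity (\sum_i \sum_f `|h p (inl (i, f)) - h q (inl (i, f))|).
      by rewrite pair_bigA; apply: eq_bigr => -[].
    rewrite /cutsum (big_nth (0, set0)) big_mkord [RHS]big_mkcond /=.
    apply: eq_bigr => i _; rewrite -/(c i) -cut_view_neq.
    have ci0 : 0 <= (c i).1 / 2 by rewrite divr_ge0// s0// mem_nth.
    under eq_bigr do rewrite -mulrBr normrM (ger0_norm ci0).
    rewrite -mulr_sumr; have [->|ne] := eqVneq (cut_view (c i).2 p) (cut_view (c i).2 q).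
      by rewrite big1 ?mulr0// => f _; rewrite subrr normr0.
    rewrite (bigD1 (cut_view (c i).2 p))//= (bigD1 (cut_view (c i).2 q)) 1?eq_sym//=.
    rewrite big1 ?addr0; last first.
      by move=> f /andP[fp fq]; rewrite eq_sym (negbTE fp) eq_sym (negbTE fq) subrr normr0.
    rewrite !eqxx (negbTE ne) subr0 sub0r normrN normr1; lra.
  rewrite -sum1_card natr_sum [RHS]big_mkcond; apply: eq_bigr => v _ /=.
  rewrite !inE; case: (v \in p.1); case: (v \in q.1) => /=.
  - by rewrite subrr normr0.
  - by rewrite subr0 normr1.
  - by rewrite sub0r normrN normr1.
  - by rewrite subrr normr0.
(* The scale [4^-1] compensates the factor 4 of [tsp_cutsum_splits]; the upper bound [D] then equals
   [4 * D] times the scale. *)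
apply: (@finite_l1_embeds_L1 _ _ _ I h 4^-1) => [|p q]; first by rewrite invr_gt0.
rewrite hE /lamplighter_dist.
have := tsp_cutsum_splits p.2 (symdiff p.1 q.1) q.2.
have := cutsum_splits_tsp p.2 (symdiff p.1 q.1) q.2.
have : 0 <= #|symdiff p.1 q.1|%:R :> R by [].
move: (tsp _ _ _ _) (cutsum _ _) (#|_|%:R : R) => t w k k0 wt tw.
have D1' : 0 <= (D - 1) * k by rewrite mulr_ge0 ?subr_ge0.
by apply/andP; split; lra.
Qed.

End Lamplighter.

Lemma supported_on_connected (R : realType) (G : graph) (d : G -> G -> R) (o : G) :
  supported_on d -> connected_in [set: G].
Proof.
move=> [_ [w [_ _ wd _]]]; split; first by exists o.
move=> x y _ _; have [[t [xt <- _]] _] := wd x y.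
by apply/connectP; exists t => //; apply: sub_path xt => u v uv /=; rewrite !inE.
Qed.

Theorem corollary12 (R : realType) (T : graph) (hT : is_tree T) :
  exists C_T : R, forall (G : graph) (hG : ~ is_minor T G)
    (d : G -> G -> R) (hd : supported_on d),
    embeds_L1 (lamplighter_dist d) C_T.
Proof.
pose D : R := (9 + 180 * expR 1) ^+ #|T|.+1.
have D1 : 1 <= D by apply: exprn_ege1; have := expR_gt0 (1 : R); lra.
exists (4 * D) => G hG d hd.
have [[v0]|empty] := pselect (inhabited G); last first.
  have noG (x : G) : False by apply: empty; exists.
  exists 1, (fun p => False_rect _ (noG p.2)); split => // p.
  by case: (noG p.2).
have [dm [w [w0 wsym wd dw]]] := hd.
have sG := swept_narrow (tree_minor_free_swept hT hG).
(* Any positive bound on the distances from [v0] serves, since the constant on edges is independent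
   of [tau]. *)
pose tau := 1 + \sum_v d v0 v.
have d0 := metric_ge0 dm.
have tau0 : 0 < tau by rewrite ltr_pwDl// sumr_ge0.
have otau : {in [set: G], forall v, d v0 v <= tau}.
  move=> v _; rewrite /tau (bigD1 v)//= addrCA lerDl addr_ge0// sumr_ge0//.
have [s [[s0 _ s_split _] s_edge _]] :=
  narrow_adapted dm (supported_on_connected v0 hd) sG tau0 otau.
apply: (lamplighter_embeds_L1 dm s0) => // [C|u v]; first exact: s_split.
have [[t [ut <- ->]] _] := wd u v.
(* The edge bound extends to all pairs along a walk attaining [d u v]: a cut separating its ends
   splits its vertex set. *)
apply: (@le_trans _ _ (cutsum s (splits [set z in u :: t]))).
  apply: cutsum_le => // c _; rewrite /separates => uv.
  have [ui vi] : u \in [set z in u :: t] /\ last u t \in [set z in u :: t].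
    by rewrite !inE eqxx -in_cons mem_last.
  have [uc|uc] := boolP (u \in c.2); have [vc|vc] := boolP (last u t \in c.2);
    rewrite ?uc ?(negbTE uc) ?vc ?(negbTE vc) in uv => //.
    by apply/andP; split; [apply/set0Pn; exists u; rewrite in_setI uc|apply/subsetPn; exists (last u t)].
  by apply/andP; split; [apply/set0Pn; exists (last u t); rewrite in_setI vc|apply/subsetPn; exists u].
apply: le_trans (cutsum_splits_walk s0 u t) _.
elim: t u ut => [|y t IH] u /=; first by rewrite /seq_length !big_nil mulr0.
move=> /andP[uy yt]; rewrite !seq_length_cons mulrDr lerD ?IH// -dw//.
by apply: s_edge; rewrite ?inE.
Qed.
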